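(* Let $k$ be an algebraically closed field, let $A$ be a polytopal $k$-algebra, and let $B$ be a (graded) retract of $A$. If the Krull dimension satisfies $\dim B\le 2$, then $B$ is polytopal, i.e. there is a lattice polytope $Q$ with $B\cong k[Q]$ as graded $k$-algebras.
   Context: A lattice polytope $P\subset\mathbb{R}^n$ is the convex hull of a finite set of points of $\mathbb{Z}^n$ (the empty polytope is allowed, with $k[\emptyset]=k$). Put $L_P=P\cap\mathbb{Z}^n$, and let $S_P\subset\mathbb{Z}^{n+1}$ be the sub-semigroup (with $0$) generated by $\{(x,1)\mid x\in L_P\}$. The algebra $k[P]:=k[S_P]$ is the semigroup algebra of $S_P$, graded by the last coordinate (so the elements of $L_P$ form a basis of the degree $1$ part, and $k[P]$ is generated in degree $1$). A graded $k$-algebra is called polytopal if it is isomorphic, as a graded $k$-algebra, to $k[P]$ for some lattice polytope $P$. A (graded) retract of a graded $k$-algebra $A$ is a graded $k$-algebra $B$ for which there exist homogeneous (degree-preserving) $k$-algebra homomorphisms $f:B\to A$ and $g:A\to B$ with $g\circ f=1_B$; equivalently, $B\cong \mathrm{Im}(h)$ for an idempotent homogeneous $k$-algebra endomorphism $h$ of $A$. *)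

(* Defs.v *)
From HB Require Import structures.
From mathcomp Require Import all_boot all_order all_algebra.
From mathcomp Require Import boolp classical_sets reals.
From mathcomp.multinomials Require Import monalg.
From mathcomp Require Import finmap.

Set Implicit Arguments.
Unset Strict Implicit.
Unset Printing Implicit Defensive.

Import Order.TTheory GRing.Theory Num.Theory.

Local Open Scope classical_set_scope.
Local Open Scope ring_scope.

(* Graded algebras are N-graded and commutative: A is the internal direct sum
   of the subspaces hcomp d. A comAlgType is nonzero; this excludes no retract
   of a nonzero algebra, as retractions are unital. *)
Record gradedAlg (k : fieldType) := GradedAlg {
  galg :> comAlgType k;
  hcomp : nat -> {pred galg};
  hcomp_submod : forall d, submod_closed (hcomp d);
  hcomp1 : 1 \in hcomp 0%N;
  hcompM : forall d e (a b : galg),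
    a \in hcomp d -> b \in hcomp e -> a * b \in hcomp (d + e)%N;
  hcomp_sum : forall a : galg, exists (N : nat) (c : nat -> galg),
    (forall d, c d \in hcomp d) /\ a = \sum_(d < N) c d;
  hcomp_direct : forall (N : nat) (c : nat -> galg),
    (forall d, c d \in hcomp d) -> \sum_(d < N) c d = 0 ->
    forall d, (d < N)%N -> c d = 0
}.

Arguments hcomp {k} A d : rename.

Section GradedMorphisms.
Variable k : fieldType.

Definition homogeneous (A B : gradedAlg k) (f : A -> B) : Prop :=
  forall d a, a \in hcomp A d -> f a \in hcomp B d.

Definition graded_iso (A B : gradedAlg k) : Prop :=
  exists (f : {lrmorphism A -> B}) (g : {lrmorphism B -> A}),
    [/\ homogeneous f, homogeneous g, cancel f g & cancel g f].

Definition graded_retract (A B : gradedAlg k) : Prop :=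
  exists (f : {lrmorphism B -> A}) (g : {lrmorphism A -> B}),
    [/\ homogeneous f, homogeneous g & cancel f g].

End GradedMorphisms.

Definition prime_ideal (A : comNzRingType) (p : {pred A}) : Prop :=
  idealr_closed p /\ prime_idealr_closed p.

(* p 0, ..., p m is a strictly increasing chain of primes; its length is m. *)
Definition prime_chain (A : comNzRingType) (m : nat) (p : nat -> {pred A}) :
    Prop :=
  (forall i, (i <= m)%N -> prime_ideal (p i)) /\
  (forall i, (i < m)%N ->
     {subset p i <= p i.+1} /\ ~ {subset p i.+1 <= p i}).

(* The Krull dimension, the supremum of the lengths of the chains of primes,
   is at most d. *)
Definition krull_dim_le (A : comNzRingType) (d : nat) : Prop :=
  forall m (p : nat -> {pred A}), prime_chain m p -> (m <= d)%N.

Section LatticePolytopes.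
Variables (R : realType) (n : nat).

(* The hull of the empty sequence is empty, since then \sum_i c i = 0. *)
Definition conv_hull (s : seq 'rV[R]_n) : set 'rV[R]_n :=
  [set x | exists c : 'I_(size s) -> R,
     [/\ forall i, 0 <= c i, \sum_i c i = 1 & x = \sum_i c i *: s`_i]].

Definition lattice_pt (x : 'rV[int]_n) : 'rV[R]_n :=
  map_mx (fun z : int => z%:~R) x.

Record latticePolytope := LatticePolytope {
  polytope_set :> set 'rV[R]_n;
  polytope_setP : exists s : seq 'rV[int]_n,
    polytope_set = conv_hull [seq lattice_pt x | x <- s]
}.

Definition lattice_points (P : latticePolytope) : set 'rV[int]_n :=
  [set x | (P : set 'rV[R]_n) (lattice_pt x)].

(* The point (x, 1) of Z^(n+1). *)
Definition homogenize (x : 'rV[int]_n) : 'rV[int]_(n + 1) := row_mx x 1%:M.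

Definition last_coord (v : 'rV[int]_(n + 1)) : int := v 0 (rshift n 0).

Definition polytope_semigroup (P : latticePolytope) : set 'rV[int]_(n + 1) :=
  [set v | exists s : seq 'rV[int]_n,
     (forall x, x \in s -> lattice_points P x) /\
     v = \sum_(x <- s) homogenize x].

Lemma last_coordD : {morph last_coord : u v / u + v}.
Proof. by move=> u v; rewrite /last_coord mxE. Qed.

Lemma last_coord_sum (s : seq 'rV[int]_n) :
  last_coord (\sum_(x <- s) homogenize x) = (size s)%:Z.
Proof.
elim: s => [|x s IHs]; first by rewrite big_nil /last_coord mxE.
by rewrite big_cons last_coordD IHs /last_coord row_mxEr mxE eqxx -intS.
Qed.

Variable P : latticePolytope.

(* polytope_semigroup P as a type, with the additive monoid structure of
   Z^(n+1). In multinomials' monalg the structures monomType and conomType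
   also require u + v = 0 -> u = v = 0, which holds by looking at the last
   coordinate. *)
Definition SP : Type := {v : 'rV[int]_(n + 1) | `[< polytope_semigroup P v >]}.

HB.instance Definition _ := Choice.on SP.

Lemma SP_zero_subproof : `[< polytope_semigroup P 0 >].
Proof. by apply/asboolP; exists [::]; split => //; rewrite big_nil. Qed.

Lemma SP_add_subproof (u v : SP) : `[< polytope_semigroup P (val u + val v) >].
Proof.
case: u v => [u +] [v +] /= => /asboolP[s [sP ->]] /asboolP[t [tP ->]].
apply/asboolP; exists (s ++ t); split; last by rewrite big_cat.
by move=> x; rewrite mem_cat => /orP[/sP|/tP].
Qed.

Definition SP_zero : SP := exist _ 0 SP_zero_subproof.
Definition SP_add (u v : SP) : SP := exist _ (val u + val v) (SP_add_subproof u v).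

Lemma SP_last_coord (u : SP) : exists d : nat, last_coord (val u) = d%:Z.
Proof.
case: u => [u] /= /asboolP[s [_ ->]].
by exists (size s); rewrite last_coord_sum.
Qed.

Lemma SP_last_coord0 (u : SP) : last_coord (val u) = 0 -> u = SP_zero.
Proof.
move=> u0; apply: val_inj => /=; case: u u0 => [u] /= /asboolP[s [_ ->]].
by rewrite last_coord_sum => -[/size0nil ->]; rewrite big_nil.
Qed.

Lemma SP_addA : associative SP_add.
Proof. by move=> u v w; apply: val_inj; rewrite /= addrA. Qed.

Lemma SP_add0 : left_id SP_zero SP_add.
Proof. by move=> u; apply: val_inj; rewrite /= add0r. Qed.

Lemma SP_addC : commutative SP_add.
Proof. by move=> u v; apply: val_inj; rewrite /= addrC. Qed.

Lemma SP_addr0 : right_id SP_zero SP_add.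
Proof. by move=> u; rewrite SP_addC SP_add0. Qed.

Lemma SP_add_eq0 u v : SP_add u v = SP_zero -> u = SP_zero /\ v = SP_zero.
Proof.
move=> /(congr1 (fun w : SP => last_coord (val w))) /=.
rewrite last_coordD {3}/last_coord mxE.
have [d ud] := SP_last_coord u; have [e ve] := SP_last_coord v.
rewrite ud ve -PoszD => -[] /eqP; rewrite addn_eq0 => /andP[/eqP d0 /eqP e0].
by split; apply: SP_last_coord0; rewrite ?ud ?ve ?d0 ?e0.
Qed.

HB.instance Definition _ :=
  Choice_isMonomialDef.Build SP SP_addA SP_add0 SP_addr0 SP_add_eq0.
HB.instance Definition _ := MonomialDef_isConomialDef.Build SP SP_addC.

End LatticePolytopes.

Section PolytopeAlgebra.
Variables (k : fieldType) (R : realType) (n : nat) (P : latticePolytope R n).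

Local Notation kP := {malg k[SP P]}.

Definition deg_comp (d : nat) : {pred kP} :=
  [pred g : kP | all (fun v : SP P => last_coord (val v) == d%:Z) (msupp g)].

Lemma deg_compP d (g : kP) :
  reflect (forall v, g@_v != 0 -> last_coord (val v) = d%:Z) (g \in deg_comp d).
Proof.
apply: (iffP allP) => h v.
  by rewrite mcoeff_neq0 => /h/eqP.
by rewrite -mcoeff_neq0 => /h ->.
Qed.

Lemma deg_comp_submod d : submod_closed (deg_comp d).
Proof.
split; first by apply/deg_compP => v; rewrite mcoeff0 eqxx.
move=> a g h /deg_compP gd /deg_compP hd; apply/deg_compP => v.
rewrite mcoeffD mcoeffZ; have [-> | /gd //] := eqVneq g@_v 0.
by rewrite mulr0 add0r => /hd.
Qed.

Lemma deg_comp1 : 1 \in deg_comp 0.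
Proof.
apply/deg_compP => v; rewrite mcoeff1.
by have [->|_] := eqVneq v mone; [rewrite /last_coord mxE | rewrite eqxx].
Qed.

Lemma deg_compM d e (a b : kP) :
  a \in deg_comp d -> b \in deg_comp e -> a * b \in deg_comp (d + e).
Proof.
move=> /deg_compP ad /deg_compP be; apply/deg_compP => v.
rewrite mcoeff_neq0 => /msuppM_le[v1 [v2 [+ + ->]]].
by rewrite -!mcoeff_neq0 => /ad v1d /be v2e; rewrite /= last_coordD v1d v2e.
Qed.

Definition deg_part (a : kP) (d : nat) : kP :=
  \sum_(v <- msupp a | last_coord (val v) == d%:Z) << a@_v *g v >>.

Lemma deg_part_coef a d v :
  (deg_part a d)@_v = if last_coord (val v) == d%:Z then a@_v else 0.
Proof.
rewrite /deg_part raddf_sum /=.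
under eq_bigr do rewrite mcoeffU.
have [va|va] := boolP (v \in msupp a); last first.
  rewrite (mcoeff_outdom va) if_same big_seq_cond big1 // => w /andP[wa _].
  by case: eqP wa va => [-> ->|].
rewrite big_mkcond (bigD1_seq v) //= eqxx mulr1n big1 ?addr0 // => w /negPf wv.
by rewrite wv mulr0n if_same.
Qed.

Lemma deg_comp_sum (a : kP) : exists (N : nat) (c : nat -> kP),
  (forall d, c d \in deg_comp d) /\ a = \sum_(d < N) c d.
Proof.
exists (\max_(v <- msupp a) `|last_coord (val v)|%N).+1, (deg_part a); split.
  by move=> d; apply/deg_compP => v; rewrite deg_part_coef;
     case: ifP => [/eqP|]; rewrite ?eqxx.
apply/malgP => v; rewrite raddf_sum /=.
under eq_bigr do rewrite deg_part_coef.
have [va|va] := boolP (v \in msupp a); last first.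
  by rewrite (mcoeff_outdom va) big1 // => i _; rewrite if_same.
have [d vd] := SP_last_coord v.
have dN : (d < (\max_(w <- msupp a) `|last_coord (val w)|%N).+1)%N.
  by rewrite ltnS -[d]/(`|d%:Z|%N) -vd; apply: (@leq_bigmax_seq _ _ predT).
rewrite (bigD1 (Ordinal dN)) //= vd eqxx big1 ?addr0 // => i.
rewrite -val_eqE /= => /negPf id.
by rewrite eqz_nat eq_sym id.
Qed.

Lemma deg_comp_direct (N : nat) (c : nat -> kP) :
  (forall d, c d \in deg_comp d) -> \sum_(d < N) c d = 0 ->
  forall d, (d < N)%N -> c d = 0.
Proof.
move=> cd c0 d dN; apply/malgP => v; rewrite mcoeff0.
have [//|cv] := eqVneq (c d)@_v 0.
have /deg_compP/(_ _ cv) vd := cd d.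
move: (congr1 (mcoeff v) c0); rewrite mcoeff0 raddf_sum /=.
rewrite (bigD1 (Ordinal dN)) //= big1 ?addr0 // => i.
rewrite -val_eqE /= => id.
have [//|ciN] := eqVneq (c i)@_v 0.
have /deg_compP/(_ _ ciN) := cd i; rewrite vd => -[di].
by rewrite di eqxx in id.
Qed.

(* k[P]: {malg k[M]} is the monoid algebra of M over k. *)
Definition polytope_alg : gradedAlg k :=
  @GradedAlg k kP deg_comp deg_comp_submod deg_comp1 deg_compM
    deg_comp_sum deg_comp_direct.

End PolytopeAlgebra.

Definition polytopal (R : realType) (k : fieldType) (A : gradedAlg k) : Prop :=
  exists (n : nat) (P : latticePolytope R n), graded_iso A (polytope_alg k P).

(* Main.v *)
Require Import Defs.
From HB Require Import structures.
From mathcomp Require Import all_boot all_order all_algebra.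
From mathcomp Require Import boolp classical_sets reals.
From mathcomp.multinomials Require Import monalg.
From mathcomp Require Import finmap.
From mathcomp Require Import ring zify.

(** Through the retraction B is a graded subalgebra of the domain k[P],
    generated in degree 1, and Proj B is a curve (or a point, or empty: then B
    is k[t] or k). The theorem holds because this curve is rational and because
    B is, in degree 1, as integrally closed as k[P] is; so B is the ring of all
    forms of degree 0, c, 2c, and so on on the projective line, which is the
    polytopal algebra of a segment of length c.

    Rationality. Lattice polytopes parametrize: evaluating monomials along a
    line s of affine space maps B to k[s][t], with t keeping track of the
    degree. If two elements of degree 1 of B are independent, then some line
    separates them, and the kernel of the evaluation along this line, the
    kernel of the evaluation at one of its points and the ideal of elements of
    positive degree form, with 0, a chain of primes. As B has dimension at most
    2, the first kernel is 0 and B embeds in k[s][t] (retract_to_curve). The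
    fractions of degree 0 of B then form a subfield of k(s), hence a field k(u)
    by Lueroth's theorem (luroth), proved here with the classical argument:
    a nonconstant coefficient of the minimal polynomial of s generates.
    Replacing s by u and dividing by a common factor, one may assume that s
    itself is a fraction of elements of B and that the elements of degree 1 of
    B are of the form p t, where p runs through a space V of polynomials of
    degree at most c without common root (reparametrize, veronese_exists).

    Integral closure. As V has no common root, V times the polynomials of
    degree at most r is the space of all polynomials of degree at most r + c,
    for r large (multiply_onto). Therefore all powers of s^j t, for j <= c,
    have a common denominator in B: these fractions are almost integral over B.
    Now k[P] contains its almost integral fractions of degree 1, because a
    lattice polytope contains all the lattice points of its convex hull
    (almost_integral_degree1); applying the retraction, so does B
    (retract_almost_integral). Hence V contains 1, s, ..., s^c (veronese), and
    B is isomorphic to the polytopal algebra of the segment (segment_iso). *)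

Set Implicit Arguments.
Unset Strict Implicit.
Unset Printing Implicit Defensive.

Import Order.TTheory GRing.Theory Num.Theory.

Local Open Scope ring_scope.

(** * Graded algebras *)

Section GradedAlgebras.
Variables (k : fieldType) (A : gradedAlg k).
Implicit Types (a b : A) (d e : nat).

Lemma hcomp0 d : 0 \in hcomp A d.
Proof. by have [] := @hcomp_submod k A d. Qed.

Lemma hcompD d a b : a \in hcomp A d -> b \in hcomp A d -> a + b \in hcomp A d.
Proof.
by have [_ sub] := @hcomp_submod k A d; move=> ad /(sub 1 _ _ ad);
   rewrite scale1r.
Qed.

Lemma hcompZ d c a : a \in hcomp A d -> c *: a \in hcomp A d.
Proof.
have [_ sub] := @hcomp_submod k A d.
by move=> /(sub c)/(_ (hcomp0 d)); rewrite addr0.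
Qed.

Lemma hcompN d a : a \in hcomp A d -> - a \in hcomp A d.
Proof. by rewrite -scaleN1r; apply: hcompZ. Qed.

Lemma hcompB d a b : a \in hcomp A d -> b \in hcomp A d -> a - b \in hcomp A d.
Proof. by move=> ad bd; apply/hcompD/hcompN. Qed.

Lemma hcompMn d a m : a \in hcomp A d -> a *+ m \in hcomp A d.
Proof. by rewrite -scaler_nat; apply: hcompZ. Qed.

Lemma hcomp_bigsum d (I : Type) (s : seq I) (Q : pred I) (F : I -> A) :
  (forall i, Q i -> F i \in hcomp A d) -> \sum_(i <- s | Q i) F i \in hcomp A d.
Proof.
move=> Fd; elim/big_rec: _ => [|i a Qi ad]; first exact: hcomp0.
exact: hcompD (Fd i Qi) ad.
Qed.

Lemma hcompX a d m : a \in hcomp A d -> a ^+ m \in hcomp A (d * m).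
Proof.
move=> ad; elim: m => [|m IHm]; first by rewrite muln0 hcomp1.
by rewrite exprS mulnS hcompM.
Qed.

(** Almost integrality of the fraction b / d, regarded as homogeneous of
    degree 1: a single denominator clears all its powers. *)
Definition almost_integral (b d : A) := exists (r : nat) (x : nat -> A),
  (forall m, x m \in hcomp A (m + r)) /\ (forall m, d * b ^+ m = d ^+ m * x m).

(** Subtracting an element of A from an almost integral fraction: expand the
    powers by the binomial formula. *)
Lemma almost_integral_sub (b d e : A) :
  almost_integral b d -> e \in hcomp A 1 -> almost_integral (b - d * e) d.
Proof.
move=> [r [x [xr xbd]]] e1.
exists r, (fun m => \sum_(i < m.+1) ((- e) ^+ i * x (m - i)%N) *+ 'C(m, i)).
split=> m.
  apply: hcomp_bigsum => i _; apply: hcompMn.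
  have im : (i <= m)%N by rewrite -ltnS.
  have -> : (m + r = 1 * i + (m - i + r))%N by rewrite mul1n addnA subnKC.
  by apply: hcompM => //; apply/hcompX/hcompN.
rewrite exprDn !mulr_sumr; apply: eq_bigr => i _.
rewrite !mulrnAr; congr (_ *+ _).
have im : (i <= m)%N by rewrite -ltnS.
rewrite -mulrN exprMn.
have -> : d ^+ m = d ^+ (m - i) * d ^+ i by rewrite -exprD subnK.
have := xbd (m - i)%N.
move: (b ^+ _) (d ^+ _) (d ^+ i) ((- e) ^+ i) (x _) => B D D' E X BDX.
rewrite (mulrA d) BDX -!mulrA; congr (_ * _).
by rewrite mulrCA; congr (_ * _); rewrite mulrC.
Qed.

Definition generated_in_degree1 := forall Q : A -> Prop,
  (forall c : k, Q (c *: 1)) -> (forall a b, Q a -> Q b -> Q (a + b)) ->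
  (forall a b, Q a -> Q b -> Q (a * b)) ->
  (forall a, a \in hcomp A 1 -> Q a) -> forall a, Q a.

Definition degree1_finite := exists (N : nat) (m : 'I_N -> A),
  (forall i, m i \in hcomp A 1) /\
  (forall a, a \in hcomp A 1 -> exists c : 'I_N -> k, a = \sum_i c i *: m i).

Definition degree1_integrally_closed := forall b d : A, d != 0 ->
  almost_integral b d -> exists2 e, e \in hcomp A 1 & b = d * e.

End GradedAlgebras.

(** * Lattice points and semigroups of lattice polytopes *)

Section ConvexHulls.
Variables (R : realType) (n : nat).
Implicit Types (s t : seq 'rV[int]_n) (P : latticePolytope R n).

Lemma lattice_points_bounded P :
  exists N : nat, forall x, lattice_points P x -> forall i, (`|x 0%R i| <= N)%N.
Proof.
have [s defP] := polytope_setP P.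
exists (\sum_(y <- s) \sum_i `|y 0%R i|)%N => x; rewrite /lattice_points /= defP.
move=> [c [c0 c1 xE]] i.
have /(congr1 (fun z : 'rV[R]_n => z 0 i)) := xE.
rewrite mxE summxE => {}xE.
rewrite -(ler_nat R) natr_absz intr_norm xE.
apply: le_trans (ler_norm_sum _ _ _) _.
rewrite -[leRHS]mul1r -[X in X * _]c1 mulr_suml; apply: ler_sum => j _.
have js : (j < size s)%N by rewrite -(size_map (@lattice_pt R n)) ltn_ord.
rewrite mxE normrM (ger0_norm (c0 j)) ler_wpM2l //.
rewrite (nth_map 0) // mxE -intr_norm -natr_absz ler_nat.
rewrite (big_nth 0) big_mkord (bigD1 (Ordinal js)) //= (bigD1 i) //=.
by rewrite -addnA leq_addr.
Qed.

Lemma lattice_points_finite P :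
  exists l : seq 'rV[int]_n, forall x, x \in l <-> lattice_points P x.
Proof.
have [N boundP] := lattice_points_bounded P.
pose point (f : {ffun 'I_n -> 'I_(N + N).+1}) : 'rV[int]_n :=
  \row_i (Posz (f i) - Posz N).
exists [seq x <- map point (enum {ffun 'I_n -> 'I_(N + N).+1}) | `[< lattice_points P x >]].
move=> x; rewrite mem_filter; split=> [/andP[/asboolP //]|Px].
apply/andP; split; first exact/asboolP.
apply/mapP; exists [ffun i => inord `|(x 0 i + N%:Z)%R|%N]; first exact: mem_enum.
apply/rowP => i; rewrite !mxE ffunE.
have xN := boundP x Px i; set z : int := x 0 i in xN *; rewrite -/z.
by move: z xN => z zN; rewrite inordK; lia.
Qed.

(** Averages of lattice points, if integral, are lattice points. *)
Lemma lattice_points_sum s P : (forall y, y \in s -> lattice_points P y) ->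
  forall x, (0 < size s)%N -> \sum_(y <- s) y = x *+ size s -> lattice_points P x.
Proof.
have [t defP] := polytope_setP P => sP x s0 sumE.
pose T := [seq @lattice_pt R n y | y <- t].
have [c [c0 csum cE]] : exists c : 'I_(size T) -> R, [/\ forall i, 0 <= c i,
    \sum_i c i = (size s)%:R & \sum_(y <- s) @lattice_pt R n y = \sum_i c i *: T`_i].
  elim: s sP {s0 sumE} => [|y s IHs] sP.
    exists (fun=> 0); split=> //; rewrite ?big_nil big1 // => i _.
    by rewrite scale0r.
  have [z zs|c [c0 csum cE]] := IHs; first by apply: sP; rewrite inE zs orbT.
  have := sP y (mem_head _ _); rewrite /lattice_points /= defP.
  move=> [d [d0 dsum dE]]; exists (fun i => d i + c i); split.
  - by move=> i; rewrite addr_ge0.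
  - by rewrite big_split dsum csum /= -natr1 addrC.
  rewrite big_cons dE cE -big_split; apply: eq_bigr => i _.
  by rewrite scalerDl.
have nzs : (size s)%:R != 0 :> R by rewrite pnatr_eq0 -lt0n.
rewrite /lattice_points /= defP; exists (fun i => (size s)%:R^-1 * c i); split.
- by move=> i; rewrite mulr_ge0 // invr_ge0.
- by rewrite -mulr_sumr csum mulVf.
have -> : @lattice_pt R n x = (size s)%:R^-1 *: \sum_(y <- s) @lattice_pt R n y.
  rewrite -(raddf_sum (map_mx (fun z : int => z%:~R : R))) /= sumE.
  rewrite raddfMn /= -scaler_nat scalerA mulVf ?scale1r //.
by rewrite cE scaler_sumr; apply: eq_bigr => i _; rewrite scalerA.
Qed.

End ConvexHulls.

Section Dickson.

Lemma monotone_subsequence (f : nat -> nat) : exists2 g : nat -> nat,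
  forall i, (g i < g i.+1)%N & forall i, (f (g i) <= f (g i.+1))%N.
Proof.
have tail_min i : exists j, (i <= j)%N /\ forall l, (i <= l)%N -> (f j <= f l)%N.
  have exv : exists v, `[< exists2 j, (i <= j)%N & f j = v >].
    by exists (f i); apply/asboolP; exists i.
  have [v /asboolP[j ij fj] vmin] := ex_minnP exv.
  exists j; split=> // l il; rewrite fj; apply: vmin.
  by apply/asboolP; exists l.
have [h hP] := choice tail_min.
pose g := fix g i := if i is i'.+1 then h (g i').+1 else h 0%N.
have g_lt i : (g i < g i.+1)%N by have [] := hP (g i).+1.
exists g => // i.
case: i => [|i] /=; first by have [_ ->] := hP 0%N.
by have [_ ->] := hP (g i).+1 => //; apply: leq_trans (g_lt i) (ltnW (g_lt i.+1)).
Qed.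

(** Dickson's lemma, for finitely many functions at once. *)
Lemma dickson (T : eqType) (l : seq T) (F : T -> nat -> nat) :
  exists2 g : nat -> nat, forall i, (g i < g i.+1)%N &
    forall t, t \in l -> forall i, (F t (g i) <= F t (g i.+1))%N.
Proof.
elim: l => [|t l [g g_lt gP]]; first by exists id.
have [h h_lt hP] := monotone_subsequence (fun i => F t (g i)).
have g_mono u : u \in l -> forall i j, (i <= j)%N -> (F u (g i) <= F u (g j))%N.
  move=> ul i j /subnK <-; elim: (j - i)%N => //= d IHd.
  by apply: leq_trans IHd _; apply: gP.
exists (g \o h) => [i|u] /=.
  have : (h i < h i.+1)%N by [].
  elim: (h i.+1) => // j IHj; rewrite ltnS leq_eqVlt => /orP[/eqP -> //|].
  by move/IHj/ltn_trans; apply.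
by rewrite inE => /predU1P[->|/g_mono gu] // i; apply/gu/ltnW.
Qed.

End Dickson.

Section AsymptoticMembership.
Variables (R : realType) (n : nat) (P : latticePolytope R n).

Lemma homogenize_sum (s : seq 'rV[int]_n) :
  \sum_(x <- s) homogenize x = row_mx (\sum_(x <- s) x) (size s)%:Z%:M.
Proof.
elim: s => [|x s IHs]; first by rewrite !big_nil /= raddf0 row_mx0.
by rewrite !big_cons IHs add_row_mx -raddfD -PoszD.
Qed.

Lemma count_mem_le_sum (s t : seq 'rV[int]_n) :
    (forall x, x \in s -> (count_mem x s <= count_mem x t)%N) ->
  exists u, [/\ {subset u <= t}, size t = (size s + size u)%N &
    \sum_(x <- t) x = \sum_(x <- s) x + \sum_(x <- u) x].
Proof.
move=> le_st; have [|s' ss' perm_s] := (count_subseqP s t).1.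
  move=> x; have [/le_st //|xs] := boolP (x \in s).
  by rewrite (count_memPn xs).
have [u perm_t] := perm_to_subseq ss'.
exists u; split.
- by move=> x xu; rewrite (perm_mem perm_t) mem_cat xu orbT.
- by rewrite (perm_size perm_t) size_cat (perm_size perm_s).
by rewrite (perm_big _ perm_t) big_cat /= (perm_big _ perm_s).
Qed.

(** The polytope being closed, the direction in which a sequence of elements of
    its semigroup goes to infinity lies over a point of it. Dickson's lemma
    replaces the limit: two elements of the sequence, written as sums of
    lattice points, differ by a sum of lattice points. *)
Lemma polytope_semigroup_asymptotic (v w : 'rV[int]_(n + 1)) :
    (forall m : nat, polytope_semigroup P (v *+ m + w)) -> last_coord v = 1 ->
  exists2 x, lattice_points P x & v = homogenize x.
Proof.
move=> vw v1; have [l lP] := lattice_points_finite P.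
have /choice[s sP] : forall m, exists s : seq 'rV[int]_n,
    (forall x, x \in s -> lattice_points P x) /\
    v *+ m + w = \sum_(x <- s) homogenize x by [].
have [g g_lt gP] := dickson l (fun x m => count_mem x (s m)).
have [u [ut szu sumu]] : exists u, [/\ {subset u <= s (g 1%N)},
    size (s (g 1%N)) = (size (s (g 0%N)) + size u)%N &
    \sum_(x <- s (g 1%N)) x = \sum_(x <- s (g 0%N)) x + \sum_(x <- u) x].
  by apply: count_mem_le_sum => x xs; apply/gP/lP; have [sPx _] := sP (g 0%N); apply: sPx.
have [_ s0E] := sP (g 0%N); have [s1P s1E] := sP (g 1%N).
have g01 : (g 0%N < g 1%N)%N by [].
have uE : v *+ (g 1%N - g 0%N) = row_mx (\sum_(x <- u) x) (size u)%:Z%:M.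
  have -> : v *+ (g 1%N - g 0%N) = (v *+ g 1%N + w) - (v *+ g 0%N + w).
    by rewrite mulrnBr 1?ltnW // opprD addrACA subrr addr0.
  rewrite s1E s0E !homogenize_sum szu sumu opp_row_mx add_row_mx.
  by rewrite -raddfB /= PoszD ![_ + _ - _]addrAC !subrr !add0r.
have szuE : (size u)%:Z = (g 1%N - g 0%N)%N%:Z.
  have /(congr1 (@last_coord n)) := uE.
  rewrite /last_coord row_mxEr mxE eqxx mulr1n mulmxnE -/(last_coord v) v1.
  by rewrite natz.
exists (lsubmx v).
  apply: (lattice_points_sum (s := u)) => [x /ut||].
  - exact: s1P.
  - by move: szuE => [->]; rewrite subn_gt0.
  have /(congr1 lsubmx) := uE; rewrite row_mxKl => <-.
  by move: szuE => [->]; apply/rowP => i; rewrite !(mxE, mulmxnE).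
apply/rowP => i; rewrite -[v in LHS]hsubmxK; congr (row_mx _ _ _ _).
by apply/rowP => j; rewrite ord1 !mxE eqxx -[RHS]v1.
Qed.

End AsymptoticMembership.

(** * Leading terms and integral closure of k[P] in degree 1 *)

Section LexicographicOrder.
Variable N : nat.
Implicit Types u v w : 'rV[int]_N.

Definition lex_pos v :=
  [exists i, (0 < v 0 i) && [forall j : 'I_N, (j < i)%N ==> (v 0 j == 0)]].

Definition lex_lt u v := lex_pos (v - u).

Lemma lex_posP v : reflect
  (exists2 i, 0 < v 0 i & forall j : 'I_N, (j < i)%N -> v 0 j = 0) (lex_pos v).
Proof.
apply: (iffP existsP) => [[i /andP[vi /forallP vj]]|[i vi vj]]; exists i => //.
  by move=> j ji; apply/eqP; have := vj j; rewrite ji.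
by rewrite vi; apply/forallP => j; apply/implyP => /vj ->.
Qed.

Lemma lex_pos0 : lex_pos 0 = false.
Proof. by apply/lex_posP => -[i]; rewrite mxE ltxx. Qed.

Lemma lex_posD u v : lex_pos u -> lex_pos v -> lex_pos (u + v).
Proof.
move=> /lex_posP[i ui uj] /lex_posP[i' vi vj]; apply/lex_posP.
have [lt_ii'|lt_i'i|eq_ii'] := ltngtP i i'.
- exists i => [|j ji]; rewrite mxE; first by rewrite vj // addr0.
  by rewrite uj // vj ?addr0 // (ltn_trans ji).
- exists i' => [|j ji]; rewrite mxE; first by rewrite uj // add0r.
  by rewrite vj // uj ?addr0 // (ltn_trans ji).
exists i => [|j ji]; rewrite mxE.
  by rewrite addr_gt0 //; have -> : i = i' by apply: val_inj.
by rewrite uj // vj ?addr0 // -eq_ii'.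
Qed.

Lemma lex_pos_total v : [\/ v = 0, lex_pos v | lex_pos (- v)].
Proof.
have [->|nzv] := eqVneq v 0; first by constructor 1.
have /existsP[i0 vi0] : [exists i, v 0 i != 0].
  apply: contraNT nzv => /existsPn v0; apply/eqP/rowP => i; rewrite mxE.
  by apply/eqP; rewrite -[_ == _]negbK v0.
case: (@arg_minnP _ i0 (fun i => v 0 i != 0) (fun i : 'I_N => i : nat) vi0) => i vi min_i.
have vj (j : 'I_N) : (j < i)%N -> v 0 j = 0.
  by move=> ji; apply/eqP; apply: contraLR ji => /min_i; rewrite -leqNgt.
case: (ltrgtP (v 0 i) 0) vi => // vi _.
  constructor 3; apply/lex_posP; exists i => [|j /vj]; rewrite mxE ?oppr_gt0 //.
  by move=> ->; rewrite oppr0.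
by constructor 2; apply/lex_posP; exists i.
Qed.

Lemma lex_ltxx u : lex_lt u u = false.
Proof. by rewrite /lex_lt subrr lex_pos0. Qed.

Lemma lex_lt_trans v u w : lex_lt u v -> lex_lt v w -> lex_lt u w.
Proof.
by rewrite /lex_lt => uv vw; have := lex_posD vw uv; rewrite addrA subrK.
Qed.

Lemma lex_lt_total u v : [\/ u = v, lex_lt u v | lex_lt v u].
Proof.
have [/eqP|uv|vu] := lex_pos_total (v - u).
- by rewrite subr_eq0 => /eqP ->; constructor 1.
- by constructor 2.
by constructor 3; rewrite /lex_lt -opprB.
Qed.

Lemma lex_lt_add2r w u v : lex_lt (u + w) (v + w) = lex_lt u v.
Proof. by rewrite /lex_lt opprD addrACA subrr addr0. Qed.

Lemma lex_ltD u v u' v' : lex_lt u v -> lex_lt u' v' -> lex_lt (u + u') (v + v').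
Proof. by move=> uv uv'; rewrite /lex_lt opprD addrACA; apply: lex_posD. Qed.

End LexicographicOrder.

Section LeadingTerms.
Variables (R : realType) (k : fieldType) (n : nat) (P : latticePolytope R n).
Local Notation kP := {malg k[SP P]}.
Implicit Types (a b : kP) (u v w : SP P).

Definition leading a v :=
  a@_v != 0 /\ forall w, a@_w != 0 -> w != v -> lex_lt (val w) (val v).

Lemma leading_exists a : a != 0 -> exists v, leading a v.
Proof.
rewrite -msupp_eq0 => nza.
have [v0 v0a] : exists v, v \in msupp a by apply/fset0Pn.
have [v va vmax] : exists2 v, v \in msupp a & forall w,
    w \in [seq w <- msupp a | w \in msupp a] -> w != v -> lex_lt (val w) (val v).
  elim: (msupp a : seq _) => [|w s [v va vmax]]; first by exists v0.
  rewrite /=; case: ifP => [wa|_]; last by exists v.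
  have [/val_inj wv|wv|vw] := lex_lt_total (val w) (val v).
  - by exists v => // w'; rewrite inE wv => /predU1P[->|/vmax//]; rewrite eqxx.
  - by exists v => // w'; rewrite inE => /predU1P[->|/vmax].
  exists w => // w'; rewrite inE => /predU1P[->|ws]; first by rewrite eqxx.
  have [->|w'v] := eqVneq w' v; first by [].
  by move=> _; apply: lex_lt_trans vw; apply: vmax.
exists v; split=> [|w]; first by rewrite mcoeff_neq0.
by rewrite mcoeff_neq0 => wa; apply: vmax; rewrite mem_filter wa.
Qed.

Lemma leading_uniq a u v : leading a u -> leading a v -> u = v.
Proof.
move=> [ua umax] [va vmax]; apply/eqP; apply: contraT => uv.
have := lex_lt_trans (umax v va _) (vmax u ua uv).
by rewrite lex_ltxx eq_sym uv => /(_ isT).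
Qed.

Lemma leading_le a u w : leading a u -> a@_w != 0 ->
  w = u \/ lex_lt (val w) (val u).
Proof.
by move=> [_ umax] wa; have [->|wu] := eqVneq w u; [left | right; apply: umax].
Qed.

(** The lexicographic order is compatible with addition, so the product of the
    leading terms meets no other product of terms. *)
Lemma leadingM a b u v : leading a u -> leading b v ->
  leading (a * b) (mmul u v) /\ (a * b)@_(mmul u v) = a@_u * b@_v.
Proof.
move=> au bv.
have lt_uv u' v' : a@_u' != 0 -> b@_v' != 0 -> (u', v') != (u, v) ->
    lex_lt (val u' + val v') (val u + val v).
  move=> /(leading_le au) hu /(leading_le bv) hv.
  case: hu hv => [->|ltu] [->|ltv]; first by rewrite eqxx.
  - by rewrite ![val u + _]addrC lex_lt_add2r.
  - by rewrite lex_lt_add2r.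
  by move=> _; apply: lex_ltD.
have coefE : (a * b)@_(mmul u v) = a@_u * b@_v.
  have zero u' v' : u' \in msupp a -> v' \in msupp b -> (u', v') != (u, v) ->
      (a@_u' * b@_v') *+ (mmul u' v' == mmul u v) = 0.
    rewrite -!mcoeff_neq0 => ua vb /(lt_uv u' v' ua vb).
    by case: eqP => // /(congr1 val) /= ->; rewrite lex_ltxx.
  have [ua _] := au; have [vb _] := bv.
  rewrite mcoeffMl (bigD1_seq u) -?mcoeff_neq0 ?fset_uniq //=.
  rewrite [X in X + _](bigD1_seq v) -?mcoeff_neq0 ?fset_uniq //= eqxx mulr1n.
  rewrite big_seq_cond big1 => [|v' /andP[v'b v'v]]; last first.
    by apply: zero => //; [rewrite -mcoeff_neq0 | rewrite xpair_eqE negb_and v'v orbT].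
  rewrite addr0 big_seq_cond big1 ?addr0 // => u' /andP[u'a u'u].
  rewrite big_seq big1 // => v' v'b.
  by apply: zero => //; rewrite xpair_eqE negb_and u'u.
split=> //; split=> [|w].
  by have [ua _] := au; have [vb _] := bv; rewrite coefE mulf_neq0.
rewrite mcoeff_neq0 => /msuppM_le[u' [v' [u'a v'b ->]]] neq.
apply: lt_uv; rewrite ?mcoeff_neq0 //.
by apply: contraNneq neq => -[-> ->].
Qed.

Lemma malg_mulf_neq0 a b : a != 0 -> b != 0 -> a * b != 0.
Proof.
move=> /leading_exists[u au] /leading_exists[v bv].
have [[uv _] _] := leadingM au bv.
by apply: contraNneq uv => ->; rewrite mcoeff0.
Qed.

Lemma malg_expf_neq0 a m : a != 0 -> a ^+ m != 0.
Proof.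
move=> nza; elim: m => [|m IHm]; first by rewrite expr0 oner_neq0.
by rewrite exprS malg_mulf_neq0.
Qed.

Lemma leadingX a u m : leading a u ->
  exists2 v, leading (a ^+ m) v & val v = val u *+ m.
Proof.
move=> au; elim: m => [|m [v av vE]].
  exists mone => //; split=> [|w]; first by rewrite mcoeff1 eqxx oner_neq0.
  by rewrite mcoeff1; case: (w == _); rewrite ?eqxx.
exists (mmul u v); first by rewrite exprS; have [] := leadingM au av.
by rewrite /= vE mulrS.
Qed.

End LeadingTerms.

Section Integrality.
Variables (R : realType) (k : fieldType) (n : nat) (P : latticePolytope R n).
Local Notation kP := {malg k[SP P]}.
Implicit Types (a b d : kP) (u v w : SP P).

Lemma semigroup_homogenize x : lattice_points P x ->
  `[< polytope_semigroup P (homogenize x) >].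
Proof.
move=> Px; apply/asboolP; exists [:: x]; rewrite big_seq1; split=> // y.
by rewrite inE => /eqP ->.
Qed.

Definition degree1 x (Px : lattice_points P x) : SP P :=
  exist _ (homogenize x) (semigroup_homogenize Px).

Lemma last_coord_homogenize (x : 'rV[int]_n) : last_coord (homogenize x) = 1.
Proof. by rewrite /last_coord row_mxEr mxE eqxx. Qed.

(** If x is the difference of the leading exponents of b and d, then every
    m x + lead d is the exponent of a monomial of k[P], so that x lies over a
    lattice point of P. Subtract from b / d the corresponding term and repeat:
    this stops, as there are finitely many lattice points. *)
Lemma almost_integral_degree1 : degree1_integrally_closed (polytope_alg k P).
Proof.
move=> b d nzd; have [dl dlead] := leading_exists nzd.
have [l lP] := lattice_points_finite P.
(* The list l contains the lattice points that can still occur. *)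
have lb u x : leading b u -> lattice_points P x ->
  ~~ lex_lt (val u) (homogenize x + val dl) -> x \in l by move=> _ /lP.
have [m] := ubnP (size l); elim: m l b lb {lP} => // m IHm l b lb szl int_b.
have [->|nzb] := eqVneq b 0.
  by exists 0; rewrite ?mulr0 //; apply: (@hcomp0 k (polytope_alg k P)).
have [bl blead] := leading_exists nzb.
have [x Px bl_dl] : exists2 x, lattice_points P x & val bl - val dl = homogenize x.
  have [r [a' [ar abd']]] := int_b.
  pose a : nat -> kP := a'.
  have abd j : d * b ^+ j = d ^+ j * a j by exact: abd'.
  have inS j : polytope_semigroup P ((val bl - val dl) *+ j + val dl) /\
      last_coord ((val bl - val dl) *+ j + val dl) = (j + r)%N%:Z.
    have nza : a j != 0.
      apply: contraTneq (malg_mulf_neq0 nzd (malg_expf_neq0 j nzb)).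
      by rewrite abd => ->; rewrite mulr0 eqxx.
    have [al alead] := leading_exists nza.
    have [bj bjlead bjE] := leadingX j blead.
    have [dj djlead djE] := leadingX j dlead.
    have [lead1 _] := leadingM dlead bjlead.
    have [lead2 _] := leadingM djlead alead.
    rewrite abd in lead1; move: (leading_uniq lead1 lead2) => /(congr1 val) /=; rewrite bjE djE => eq.
    have alE : (val bl - val dl) *+ j + val dl = val al.
      by rewrite mulrnBl addrAC [_ + val dl]addrC eq addrC addKr.
    rewrite alE; split; first exact/asboolP/(valP al).
    by have [al0 _] := alead; have /deg_compP := ar j; apply.
  apply: polytope_semigroup_asymptotic (fun j => (inS j).1) _.
  have [_] := inS 1%N; have [_] := inS 0%N.
  move: (val dl) (val bl - val dl) => w v.
  by rewrite mulr0n add0r mulr1n last_coordD => ->; rewrite add0n PoszD => /(@addIr _ r%:Z).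
pose c := b@_bl / d@_dl.
pose t : kP := << c *g degree1 Px >>.
have t1 : t \in hcomp (polytope_alg k P) 1.
  apply/deg_compP => v; rewrite mcoeffU.
  have [<- _|_] := eqVneq (degree1 Px) v; last by rewrite eqxx.
  by rewrite /= last_coord_homogenize.
have degree1_lead : val (degree1 Px) + val dl = val bl by rewrite /= -bl_dl subrK.
have tlead : leading t (degree1 Px) /\ t@_(degree1 Px) = c.
  have nzc : c != 0.
    by have [? _] := blead; have [? _] := dlead; rewrite mulf_neq0 ?invr_eq0.
  rewrite /t mcoeffUU; split=> //; split=> [|w]; first by rewrite mcoeffUU.
  by rewrite mcoeffU eq_sym; have [|_] := eqVneq w (degree1 Px);
     rewrite // mulr0n eqxx.
have [dtlead dtE] := leadingM dlead tlead.1.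
have dt_bl : mmul dl (degree1 Px) = bl by apply: val_inj; rewrite /= -degree1_lead addrC.
rewrite dt_bl tlead.2 in dtlead dtE.
have bl'_lt u : leading (b - d * t) u -> lex_lt (val u) (val bl).
  move=> [nzu _]; have : u != bl.
    apply: contraNneq nzu => ->; rewrite mcoeffB dtE mulrC divfK ?subrr //.
    by have [] := dlead.
  move: nzu; rewrite mcoeffB.
  have [->|bu] := eqVneq b@_u 0.
    by rewrite sub0r oppr_eq0 => /(leading_le dtlead)[->|//]; rewrite eqxx.
  by move=> _; have [->|//] := leading_le blead bu; rewrite eqxx.
have [|||e e1 eE] := IHm [seq y <- l | y != x] (b - d * t).
- move=> u y ulead Py u_ge; rewrite mem_filter; apply/andP; split.
    apply: contraNneq u_ge => ->; rewrite -[homogenize x]/(val (degree1 Px)).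
    by rewrite degree1_lead bl'_lt.
  apply: (lb bl y blead Py); apply: contra u_ge; apply: lex_lt_trans.
  exact: bl'_lt.
- have xl : x \in l.
    apply: (lb bl x blead Px); rewrite -[homogenize x]/(val (degree1 Px)) degree1_lead.
    by rewrite lex_ltxx.
  rewrite -ltnS; apply: leq_trans szl; rewrite ltnS size_filter.
  rewrite -(count_predC (fun y => y != x) l) -[ltnLHS]addn0 ltn_add2l.
  by rewrite -has_count; apply/hasP; exists x => //=; rewrite negbK.
- exact: (@almost_integral_sub k (polytope_alg k P)).
exists (t + e); first exact: (@hcompD k (polytope_alg k P)).
by rewrite mulrDr -eE addrC subrK.
Qed.

End Integrality.

(** * Monomials of k[P] and their evaluation *)

Section PolytopeAlgebra.
Variables (R : realType) (k : fieldType) (n : nat) (P : latticePolytope R n).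
Local Notation kP := {malg k[SP P]}.
Implicit Types (a b : kP) (u v w : SP P).

Definition sdeg v := `|last_coord (val v)|%N.

Lemma sdegE v : last_coord (val v) = (sdeg v)%:Z.
Proof. by rewrite /sdeg; have [d ->] := SP_last_coord v. Qed.

Lemma sdegM u v : sdeg (mmul u v) = (sdeg u + sdeg v)%N.
Proof. by apply/eqP; rewrite -eqz_nat PoszD -!sdegE -last_coordD. Qed.

Lemma sdeg1 : sdeg mone = 0%N.
Proof. by rewrite /sdeg /last_coord mxE. Qed.

Lemma sdeg_degree1 v : sdeg v = 1%N -> exists x (Px : lattice_points P x), v = degree1 Px.
Proof.
move=> v1; have := asboolW (valP v) => -[s [sP vE]].
have := sdegE v; rewrite v1 vE last_coord_sum.
case: s sP vE => [|x [|y s]] // sP vE _.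
have Px : lattice_points P x by apply: sP; rewrite inE.
by exists x, Px; apply: val_inj; rewrite vE big_seq1.
Qed.

Lemma sdeg_hcomp a d : a \in hcomp (polytope_alg k P) d ->
  forall v, a@_v != 0 -> sdeg v = d.
Proof. by move=> /deg_compP ad v /ad; rewrite sdegE => -[]. Qed.

Lemma monalgUM (c d : k) u v :
  << c *g u >> * << d *g v >> = << c * d *g mmul u v >> :> kP.
Proof. exact: fgmulUU. Qed.

Lemma coef_mon v w : (<< v >> : kP)@_w = (v == w)%:R.
Proof. exact: mcoeffU1. Qed.

Lemma mon_degree1 x (Px : lattice_points P x) :
  << degree1 Px >> \in hcomp (polytope_alg k P) 1.
Proof.
apply/deg_compP => v; rewrite coef_mon.
have [<- _|_] := eqVneq (degree1 Px) v; last by rewrite eqxx.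
by rewrite /= last_coord_homogenize.
Qed.

Lemma monalgU_scale (c : k) v : << c *g v >> = c *: << v >> :> kP.
Proof.
apply/malgP => w; rewrite [RHS]mcoeffZ.
transitivity (c *+ (v == w)); first exact: mcoeffU.
transitivity (c * (v == w)%:R); first by rewrite mulr_natr.
by congr (_ * _); apply/esym/coef_mon.
Qed.

Lemma polytope_alg_ind (Q : kP -> Prop) :
    (forall c : k, Q (c *: 1)) -> (forall a b, Q a -> Q b -> Q (a + b)) ->
    (forall a b, Q a -> Q b -> Q (a * b)) ->
    (forall x (Px : lattice_points P x), Q << degree1 Px >>) ->
  forall a, Q a.
Proof.
move=> Qc QD QM Q1 a.
have QU v : Q << v >>.
  have [s [sP vE]] := asboolW (valP v).
  elim: s v sP vE => [|x s IHs] v sP vE.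
    have -> : v = mone by apply: val_inj; rewrite vE big_nil.
    by have := Qc 1; rewrite scale1r.
  have Px : lattice_points P x by apply: sP; rewrite mem_head.
  have sP' y : y \in s -> lattice_points P y by move=> ys; apply: sP; rewrite inE ys orbT.
  have Sw : `[< polytope_semigroup P (\sum_(y <- s) homogenize y) >].
    by apply/asboolP; exists s.
  pose w : SP P := exist (fun z => is_true `[< polytope_semigroup P z >]) _ Sw.
  have -> : v = mmul (degree1 Px) w by apply: val_inj; rewrite vE big_cons.
  by rewrite -[1]mulr1 -monalgUM; apply: QM (Q1 x Px) (IHs w sP' erefl).
rewrite [a]monalgE; elim: (msupp a : seq _) => [|v s IHs].
  by rewrite big_nil -(scale0r 1); apply: Qc.
rewrite big_cons; apply: QD => //.
have -> : << a@_v *g v >> = (a@_v *: 1) * << v >> :> kP.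
  by rewrite -scalerAl mul1r monalgU_scale.
by apply: (QM (a@_v *: 1) << v >>); [apply: Qc | apply: QU].
Qed.

Lemma degree1_span : degree1_finite (polytope_alg k P).
Proof.
have [l lP] := lattice_points_finite P.
pose mono x : kP := if pselect (lattice_points P x) is left Px then << degree1 Px >> else 0.
pose s := undup l.
exists (size s), (fun i => mono s`_i : polytope_alg k P); split=> [i|a a1].
  rewrite /mono; case: pselect => [Px|_]; last exact: (@hcomp0 k (polytope_alg k P)).
  exact: mon_degree1.
pose coord x : k := if pselect (lattice_points P x) is left Px then a@_(degree1 Px) else 0.
exists (fun i => coord s`_i).
rewrite -(big_mkord predT (fun i => coord s`_i *: mono s`_i)).
rewrite -(big_nth 0 predT (fun x => coord x *: mono x)).
apply/malgP => v; rewrite raddf_sum /=.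
have [v1|v1] := eqVneq (sdeg v) 1%N; last first.
  rewrite big1 => [|x _]; last first.
    rewrite mcoeffZ /mono; case: pselect => [Px|_]; last by rewrite mcoeff0 mulr0.
    rewrite (coef_mon (degree1 Px)); case: eqP => [vE|_]; last by rewrite mulr0.
    by rewrite -vE /sdeg /= last_coord_homogenize in v1.
  by apply/eqP; apply: contraNT v1 => /(sdeg_hcomp a1) ->.
have [x [Px ->]] := sdeg_degree1 v1.
have xs : x \in s by rewrite mem_undup; apply/lP.
rewrite (bigD1_seq x) ?undup_uniq //= /coord /mono.
case: pselect => // Px'; rewrite (Prop_irrelevance Px' Px).
rewrite [X in X + _]mcoeffZ (coef_mon (degree1 Px)) eqxx mulr1.
rewrite big1 ?addr0 // => y yx.
case: pselect => [Py|_]; last by rewrite scale0r mcoeff0.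
rewrite [LHS]mcoeffZ (coef_mon (degree1 Py)).
have [/(congr1 val)/eq_row_mx[eq _]|_] := eqVneq (degree1 Py) (degree1 Px).
  by rewrite eq eqxx in yx.
by rewrite mulr0.
Qed.

(** Translating P into the positive orthant makes the exponents natural
    numbers, so that monomials can be evaluated where coordinates vanish. *)
Lemma exponents_exist : exists e : SP P -> 'I_n -> nat,
  [/\ forall i, e mone i = 0%N, forall u v i, e (mmul u v) i = (e u i + e v i)%N &
      forall u v, sdeg u = sdeg v -> e u =1 e v -> u = v].
Proof.
have [N boundP] := lattice_points_bounded P.
pose z v i : int := val v 0 (lshift 1 i) + N%:Z * last_coord (val v).
have z_ge0 v i : 0 <= z v i.
  have [s [sP vE]] := asboolW (valP v); rewrite /z vE {vE}.
  elim: s sP => [|x s IHs] sP; first by rewrite big_nil /last_coord !mxE mulr0.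
  have Px : lattice_points P x by apply: sP; rewrite mem_head.
  have := IHs (fun y ys => sP y (mem_behead (s := x :: s) ys)).
  rewrite big_cons last_coordD last_coord_homogenize mxE row_mxEl.
  move: (\sum_(_ <- _) _) => y.
  have := boundP x Px i; move: (x 0 i) (last_coord _) (y _ _) => a b c.
  by rewrite mulrDr mulr1; lia.
exists (fun v i => `|z v i|%N); split=> [i|u v i|u v uv euv].
- by rewrite /z /last_coord !mxE mulr0.
- apply/eqP; rewrite -eqz_nat PoszD !gez0_abs //.
  by rewrite /z /= last_coordD mxE mulrDr addrACA.
have luv : last_coord (val u) = last_coord (val v) by rewrite !sdegE uv.
apply/val_inj/rowP => j; case: (split_ordP j) => i ->; last by rewrite ord1.
have := euv i; move=> /(congr1 Posz); rewrite !gez0_abs // /z luv.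
exact: addIr.
Qed.

End PolytopeAlgebra.

Section Evaluation.
Variables (R : realType) (k : fieldType) (n : nat) (P : latticePolytope R n).
Local Notation kP := {malg k[SP P]}.
Local Notation kst := {poly {poly k}}.
Implicit Types (a b : kP) (u v w : SP P).

Lemma monoid_algebra_eval (C : comNzRingType) (i : {rmorphism k -> C}) (h : SP P -> C) :
    h mone = 1 -> (forall u v, h (mmul u v) = h u * h v) ->
  exists Phi : {rmorphism kP -> C},
    [/\ forall a, Phi a = \sum_(v <- msupp a) i a@_v * h v,
        forall c a, Phi (c *: a) = i c * Phi a & forall v, Phi << v >> = h v].
Proof.
move=> h1 hM.
pose H : MMorphism.type (SP P) C := HB.pack h (isMultiplicative.Build _ _ h (hM, h1)).
exists (mmap i H); split=> [//|c a|v]; first exact: (@mmapZ _ _ _ i H).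
have /= -> := @mmapU _ _ _ i h 1 v.
by rewrite rmorph1 mul1r.
Qed.

(** Evaluation of the monomials of k[P] at a point with polynomial coordinates;
    the outer variable keeps track of the degree. *)
Lemma polytope_eval (chi : SP P -> {poly k}) :
    chi mone = 1 -> (forall u v, chi (mmul u v) = chi u * chi v) ->
  exists Phi : {rmorphism polytope_alg k P -> kst},
    [/\ forall c a, Phi (c *: a) = c%:P%:P * Phi a,
        forall v, Phi << v >> = chi v *: 'X^(sdeg v) &
        forall d a, a \in hcomp (polytope_alg k P) d ->
          Phi a = (\sum_(v <- msupp (a : kP)) (a : kP)@_v *: chi v) *: 'X^d].
Proof.
move=> chi1 chiM.
have [||Phi [PhiE PhiZ PhiU]] :=
    @monoid_algebra_eval kst (polyC \o polyC) (fun v => chi v *: 'X^(sdeg v)).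
- by rewrite chi1 sdeg1 scale1r.
- by move=> u v; rewrite chiM sdegM exprD -scalerAl -scalerAr scalerA.
exists Phi; split=> // d a ad; rewrite PhiE scaler_suml.
rewrite [LHS]big_seq_cond [RHS]big_seq_cond; apply: eq_bigr => v /andP[va _].
rewrite (sdeg_hcomp ad) ?mcoeff_neq0 //=.
by rewrite mul_polyC scalerA mul_polyC.
Qed.

End Evaluation.

Section MonomialFunctions.
Variable k : closedFieldType.

Lemma expr_separates (p q : nat) : p != q -> exists x : k, x ^+ p != x ^+ q.
Proof.
wlog lt_pq : p q / (p < q)%N => [th pq|_].
  have [lt_pq|lt_qp] := orP (etrans (esym (neq_ltn p q)) pq); first exact: th.
  by have [|x xE] := th q p lt_qp; [rewrite eq_sym | exists x; rewrite eq_sym].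
have /closed_rootP[x] : size ('X^q - ('X^p - 1%:P) : {poly k}) != 1%N.
  rewrite size_polyDl size_polyXn ?eqSS -?lt0n ?(leq_ltn_trans _ lt_pq) //.
  by rewrite size_polyN (leq_ltn_trans (size_polyD _ _)) // gtn_max size_polyXn
     size_polyN size_polyC oner_eq0 !ltnS lt_pq (leq_ltn_trans _ lt_pq).
rewrite rootE !hornerE => /eqP xE; exists x; apply/eqP => eq.
by move: xE; rewrite eq opprB addrC subrK => /eqP; rewrite oner_eq0.
Qed.

(** Artin's independence of characters: a relation between distinct
    multiplicative functions can be shortened. *)
Lemma monomials_independent (n : nat) (T : eqType) (e : T -> 'I_n -> nat)
    (s : seq T) (c : T -> k) :
    uniq s -> {in s &, forall t u, e t =1 e u -> t = u} ->
    (forall x : 'I_n -> k, \sum_(t <- s) c t * \prod_i x i ^+ e t i = 0) ->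
  forall t, t \in s -> c t = 0.
Proof.
pose chi t (x : 'I_n -> k) := \prod_i x i ^+ e t i.
have chiM t x y : chi t (fun i => x i * y i) = chi t x * chi t y.
  by rewrite /chi -big_split; apply: eq_bigr => i _; rewrite exprMn.
elim: s c => [|u s IHs] c //= /andP[us uniq_s] e_inj sum0.
have cs t : t \in s -> c t = 0.
  move=> ts; have tu : t != u by apply: contraNneq us => <-.
  have [y chi_tu] : exists y, chi t y != chi u y.
    apply: contrapT => /forallNP allE; move: tu => /eqP; apply.
    apply: e_inj => [||i]; rewrite ?mem_head ?inE ?ts ?orbT //.
    apply/eqP; apply: contrapT => /negP/expr_separates[z zE].
    apply: (allE (fun j => if j == i then z else 1)).
    rewrite /chi (bigD1 i) //= [X in _ != X](bigD1 i) //= !eqxx.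
    by rewrite !big1 ?mulr1 // => j /negPf ->; rewrite expr1n.
  have e_inj' : {in s &, forall v w, e v =1 e w -> v = w}.
    by move=> v w vs ws; apply: e_inj; rewrite inE ?vs ?ws orbT.
  have sum0' x : \sum_(v <- s) c v * (chi v y - chi u y) * \prod_i x i ^+ e v i = 0.
    have := sum0 (fun i => x i * y i); have := sum0 x.
    rewrite !big_cons => /(congr1 ( *%R^~ (chi u y))); rewrite mul0r => E1 E2.
    have := congr2 (fun p q => p - q) E2 E1; rewrite /= subr0; apply: etrans.
    rewrite mulrDl -!/(chi _ _) chiM mulrA opprD addrACA subrr add0r.
    rewrite mulr_suml -sumrB; apply: eq_bigr => v _; rewrite -!/(chi _ _) chiM.
    by move: (c v) (chi v y) (chi u y) (chi v x) => C A B D; ring.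
  have /eqP := IHs _ uniq_s e_inj' sum0' t ts.
  by rewrite mulf_eq0 subr_eq0 (negPf chi_tu) orbF => /eqP.
move=> t; rewrite inE => /predU1P[->|/cs //].
have := sum0 (fun=> 1); rewrite big_cons [X in _ + X]big_seq [X in _ + X]big1 => [|v vs];
  last by rewrite cs ?mul0r.
by rewrite addr0 big1 ?mulr1 // => i _; rewrite expr1n.
Qed.

End MonomialFunctions.

(** * The embedding in k[s][t] given by the dimension *)

(** In {poly {poly k}} the inner variable s is the coordinate on a line, which
    parametrizes Proj B, and the outer variable t has degree 1. *)
Definition curve_embedding (k : fieldType) (B : gradedAlg k)
    (Phi : {rmorphism B -> {poly {poly k}}}) :=
  [/\ injective Phi, forall c b, Phi (c *: b) = c%:P%:P * Phi b &
      forall d b, b \in hcomp B d -> exists p, Phi b = p *: 'X^d].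

Lemma kernel_prime (A : comNzRingType) (D : idomainType) (h : {rmorphism A -> D}) :
  prime_ideal [pred a | h a == 0].
Proof.
split; first split.
- by rewrite inE rmorph0.
- by rewrite inE rmorph1 oner_eq0.
- by move=> a u v; rewrite !inE rmorphD rmorphM => /eqP -> /eqP ->; rewrite mulr0 addr0.
by move=> u v; rewrite !inE rmorphM mulf_eq0.
Qed.

Section Retract.
Variables (R : realType) (k : closedFieldType) (n : nat) (P : latticePolytope R n).
Variables (B : gradedAlg k).
Variables (f : {lrmorphism B -> polytope_alg k P}) (g : {lrmorphism polytope_alg k P -> B}).
Hypotheses (fhom : homogeneous f) (ghom : homogeneous g) (fK : cancel f g).
Local Notation kP := {malg k[SP P]}.
Local Notation kst := {poly {poly k}}.
Implicit Types (b : B).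

Lemma retract_ind (Q : B -> Prop) :
    (forall c : k, Q (c *: 1)) -> (forall b b', Q b -> Q b' -> Q (b + b')) ->
    (forall b b', Q b -> Q b' -> Q (b * b')) ->
    (forall b, b \in hcomp B 1 -> Q b) ->
  forall b, Q b.
Proof.
move=> Qc QD QM Q1 b; rewrite -(fK b); move: (f b).
apply: (@polytope_alg_ind R k n P (fun a => Q (g a))) => [c|a a' Qa Qa'|a a' Qa Qa'|x Px].
- by rewrite linearZ rmorph1; apply: Qc.
- by rewrite raddfD; apply: QD.
- by rewrite rmorphM; apply: QM.
by apply/Q1/ghom/mon_degree1.
Qed.

Lemma retract_degree1_span : degree1_finite B.
Proof.
have [N [m [m1 mP]]] := degree1_span k P.
exists N, (fun i => g (m i)); split=> [i|b b1]; first exact/ghom/m1.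
have [c bE] := mP _ (fhom b1); exists c.
rewrite -[LHS]fK bE raddf_sum; apply: eq_bigr => i _.
have gZ d (a : polytope_alg k P) : g (d *: a) = d *: g a by rewrite linearZ.
exact: gZ.
Qed.

Lemma retract_mulf_neq0 b b' : b != 0 -> b' != 0 -> b * b' != 0.
Proof.
have f_neq0 z : z != 0 -> f z != 0.
  by apply: contraNneq => fz; rewrite -(fK z) fz raddf0.
move=> /f_neq0 nzb /f_neq0 nzb'; have := malg_mulf_neq0 nzb nzb'.
by apply: contraNneq => bb'; have := rmorphM f b b'; rewrite bb' raddf0 => <-.
Qed.

(** The fraction lies in k[P], and the retraction fixes its numerator and its
    denominator. *)
Lemma retract_almost_integral : degree1_integrally_closed B.
Proof.
move=> b d nzd [r [x [xr xbd]]].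
have nzfd : f d != 0 by apply: contraNneq nzd => fd; rewrite -(fK d) fd raddf0.
have [|e e1 fbE] := @almost_integral_degree1 R k n P (f b) (f d) nzfd.
  exists r, (f \o x); split=> m; first exact/fhom.
  by have := congr1 f (xbd m); rewrite !rmorphM !rmorphXn.
exists (g e); first exact: ghom.
have := congr1 g fbE; rewrite fK => ->; rewrite [LHS](rmorphM g).
by congr (_ * _); apply: fK.
Qed.

Let value (e : SP P -> 'I_n -> nat) (a : kP) (x : 'I_n -> k) : k :=
  \sum_(v <- msupp a) a@_v * \prod_i x i ^+ e v i.

Lemma value_neq0 e (a : kP) : {in msupp a &, forall u v, e u =1 e v -> u = v} ->
  a != 0 -> exists x, value e a x != 0.
Proof.
move=> e_inj; apply: contraNP => /forallNP a0; apply/eqP/malgP => v; rewrite mcoeff0.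
have [va|/mcoeff_outdom //] := boolP (v \in msupp a).
apply: (monomials_independent (fset_uniq (msupp a)) e_inj _ va) => x.
by apply/eqP; rewrite -[_ == _]negbK; apply/negP/a0.
Qed.

(** If the degree 1 part of B is spanned by b, then B = k[b], and the injectivity
    of Phi only depends on its value at b. *)
Lemma proportional_injective (Phi : {rmorphism B -> kst}) b :
    (forall c z, Phi (c *: z) = c%:P%:P * Phi z) ->
    (exists2 p, p != 0 & Phi b = p *: 'X) ->
    (forall b', b' \in hcomp B 1 -> exists c, b' = c *: b) ->
  injective Phi.
Proof.
move=> PhiZ [p nzp Phib] prop.
have alg z : exists q, z = horner_alg b q.
  apply: (retract_ind (Q := fun z => exists q, z = horner_alg b q)) => [c|y y'|y y'|y /prop[c ->]].
  - by exists c%:P; rewrite horner_algC.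
  - by case=> q -> [q' ->]; exists (q + q'); rewrite raddfD.
  - by case=> q -> [q' ->]; exists (q * q'); rewrite rmorphM.
  by exists (c%:P * 'X); rewrite rmorphM /= horner_algC horner_algX mulr_algl.
apply: raddf_inj => z; have [q ->] := alg z => {z}.
have -> : horner_alg b q = \sum_(i < size q) q`_i *: b ^+ i.
  rewrite -[in LHS](coefK q) poly_def raddf_sum; apply: eq_bigr => i _.
  by rewrite /= -mul_polyC rmorphM rmorphXn /= horner_algC horner_algX mulr_algl.
rewrite raddf_sum => Phi0; apply: big1 => i _.
have /(congr1 (fun r : kst => r`_i)) := Phi0.
rewrite coef_sum coef0 (bigD1 i) //= big1 ?addr0 => [|j ji].
  rewrite PhiZ rmorphXn /= Phib exprZn coefCM coefZ coefXn eqxx mulr1 => /eqP.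
  by rewrite mul_polyC scaler_eq0 expf_eq0 (negPf nzp) andbF orbF => /eqP ->; rewrite scale0r.
rewrite PhiZ rmorphXn /= Phib exprZn coefCM coefZ coefXn eq_sym -val_eqE in ji *.
by rewrite (negPf ji) !mulr0.
Qed.

(** A point of affine space gives a prime ideal of B, and so does a curve
    through it; together with 0 and the ideal of elements of positive degree
    they form a chain of length 3 unless B restricts injectively to the curve.
    A line joining two points that separate two independent elements of degree
    1 will do. *)
Lemma retract_to_curve : krull_dim_le B 2 ->
  exists Phi : {rmorphism B -> kst}, curve_embedding Phi.
Proof.
move=> dimB; have [e [e1 eM e_inj]] := exponents_exist P.
have value_degree1 a : a \in hcomp (polytope_alg k P) 1 -> a != 0 ->
    exists x, value e a x != 0.
  move=> a1; apply: value_neq0 => u v ua va; apply: e_inj.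
  by rewrite !(sdeg_hcomp a1) ?mcoeff_neq0.
have curve (gamma : 'I_n -> {poly k}) : exists Phi : {rmorphism B -> kst},
    [/\ forall c b, Phi (c *: b) = c%:P%:P * Phi b,
        forall d b, b \in hcomp B d -> exists p, Phi b = p *: 'X^d &
        forall b, b \in hcomp B 1 -> exists2 p, Phi b = p *: 'X &
          forall s, p.[s] = value e (f b) (fun i => (gamma i).[s])].
  have [||Phi [PhiZ _ Phih]] := @polytope_eval R k n P (fun v => \prod_i gamma i ^+ e v i).
  - by apply: big1 => i _; rewrite e1.
  - by move=> u v; rewrite -big_split; apply: eq_bigr => i _; rewrite eM exprD.
  exists (Phi \o f : {rmorphism B -> kst}); split=> [c b|d b bd|b b1].
  - by rewrite /= linearZ PhiZ.
  - by have := Phih d _ (fhom bd) => /= ->; eexists.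
  have := Phih 1%N _ (fhom b1) => /= ->; eexists; first by [].
  move=> s; rewrite horner_sum; apply: eq_bigr => v _.
  by rewrite hornerZ horner_prod; congr (_ * _); apply: eq_bigr => i _; rewrite horner_exp.
have f_neq0 z : z != 0 -> f z != 0.
  by apply: contraNneq => fz; rewrite -(fK z) fz raddf0.
have [[b b1 nzb]|B1_0] := pselect (exists2 b, b \in hcomp B 1 & b != 0); last first.
  have [Phi [PhiZ Phih _]] := curve (fun=> 0).
  suff ker z : Phi z = 0 -> z = 0 by exists Phi; split=> //; apply: raddf_inj ker.
  have [c ->] : exists c : k, z = c *: 1.
    apply: (retract_ind (Q := fun z => exists c : k, z = c *: 1)) => [c|y y'|y y'|y y1].
    - by exists c.
    - by case=> c -> [c' ->]; exists (c + c'); rewrite scalerDl.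
    - by case=> c -> [c' ->]; exists (c * c'); rewrite -scalerAl mul1r scalerA.
    exists 0; rewrite scale0r; apply/eqP; apply: contrapT => /negP nzy.
    by apply: B1_0; exists y.
  rewrite PhiZ rmorph1 mulr1 => /eqP; rewrite !polyC_eq0 => /eqP ->.
  by rewrite scale0r.
have [x vbx] := value_degree1 _ (fhom b1) (f_neq0 _ nzb).
have [prop|noprop] := pselect (forall b', b' \in hcomp B 1 -> exists c, b' = c *: b).
  have [Phi [PhiZ Phih Phi1]] := curve (fun i => (x i)%:P).
  exists Phi; split=> //; apply: proportional_injective prop => //.
  have [p -> pE] := Phi1 b b1; exists p => //; apply: contraNneq vbx => p0.
  have := pE 0; rewrite p0 horner0 => /esym; rewrite /value => eq.
  apply/eqP; apply: etrans eq; apply: eq_bigr => v _; congr (_ * _).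
  by apply: eq_bigr => i _; rewrite hornerC.
have [b' [b'1 b'_indep]] : exists b', b' \in hcomp B 1 /\ forall c, b' != c *: b.
  apply: contrapT => /forallNP no; apply: noprop => b' b'1.
  apply: contrapT => /forallNP b'_indep; apply: (no b'); split=> // c.
  exact/eqP/b'_indep.
(* The combination w of b and b' that vanishes at x; it does not at y. *)
pose w := value e (f b) x *: b' - value e (f b') x *: b.
have w1 : w \in hcomp B 1 by apply: hcompB; apply: hcompZ.
have nzw : w != 0.
  apply: contraTneq isT => /eqP; rewrite subr_eq0 => /eqP eq.
  have /eqP := b'_indep (value e (f b') x / value e (f b) x); case.
  by rewrite mulrC -scalerA -eq scalerA mulVf ?scale1r.
have [y wy] := value_degree1 _ (fhom w1) (f_neq0 _ nzw).
have [Phi [PhiZ Phih Phi1]] := curve (fun i => (x i)%:P + (y i - x i) *: 'X).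
have line0 z p : (forall s, p.[s] = value e (f z)
    (fun i => ((x i)%:P + (y i - x i) *: 'X).[s])) -> p.[0] = value e (f z) x.
  move=> ->; apply: eq_bigr => v _; congr (_ * _); apply: eq_bigr => i _.
  by rewrite hornerD hornerZ hornerX hornerC mulr0 addr0.
have line1 z p : (forall s, p.[s] = value e (f z)
    (fun i => ((x i)%:P + (y i - x i) *: 'X).[s])) -> p.[1] = value e (f z) y.
  move=> ->; apply: eq_bigr => v _; congr (_ * _); apply: eq_bigr => i _.
  by rewrite hornerD hornerZ hornerX hornerC mulr1 addrC subrK.
exists Phi; split=> //.
suff ker z : Phi z = 0 -> z = 0 by apply: raddf_inj ker.
move=> Phiz; apply/eqP; apply: contraT => nzz.
pose at_x : {rmorphism kst -> {poly k}} := map_poly (horner_eval 0).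
pose at_0 : {rmorphism {poly k} -> k} := horner_eval 0.
pose p i : {pred B} := if i is i'.+1 then if i' is i''.+1 then
    if i'' is _.+1 then [pred b | at_0 (at_x (Phi b)) == 0]
    else [pred b | at_x (Phi b) == 0]
  else [pred b | Phi b == 0] else [pred b | b == 0].
have at_xZ q : at_x (q *: 'X) = q.[0] *: 'X by rewrite /= map_polyZ map_polyX.
have Xneq0 (D : idomainType) (q : D) : q != 0 -> q *: 'X != 0 :> {poly D}.
  by move=> nzq; rewrite -mul_polyC mulf_eq0 polyC_eq0 (negPf nzq) polyX_eq0.
have zero_prime : prime_ideal [pred b : B | b == 0].
  split; first split; rewrite ?inE ?oner_eq0 //.
    by move=> a u v; rewrite !inE => /eqP -> /eqP ->; rewrite mulr0 addr0.
  move=> u v; rewrite !inE; apply: contraTT; rewrite negb_or => /andP[nzu nzv].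
  exact: retract_mulf_neq0.
have Phiw : at_x (Phi w) = 0 /\ Phi w != 0.
  split.
    have [q Phib qE] := Phi1 b b1; have [q' Phib' q'E] := Phi1 b' b'1.
    have -> : Phi w = (value e (f b) x *: q' - value e (f b') x *: q) *: 'X.
      by rewrite /w rmorphB !PhiZ Phib Phib' !mul_polyC scalerBl !scalerA !mul_polyC.
    rewrite at_xZ hornerD hornerN !hornerZ (line0 _ _ qE) (line0 _ _ q'E).
    by rewrite mulrC subrr scale0r.
  have [q -> qE] := Phi1 w w1.
  apply: Xneq0; apply: contraNneq wy => q0.
  by rewrite -(line1 _ _ qE) q0 horner0.
have Phib : at_x (Phi b) != 0 /\ at_0 (at_x (Phi b)) = 0.
  have [q -> qE] := Phi1 b b1; rewrite at_xZ (line0 _ _ qE); split; first exact: Xneq0.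
  by rewrite /= /horner_eval hornerZ hornerX mulr0.
have chain : prime_chain 3 p.
  split=> [[|[|[|[|i]]]]|[|[|[|i]]]] // _; rewrite /p.
  - exact: kernel_prime.
  - exact: (kernel_prime (at_x \o Phi)).
  - exact: (kernel_prime (at_0 \o at_x \o Phi)).
  - split=> [a|sub]; first by rewrite !inE => /eqP ->; rewrite raddf0.
    by have := sub z; rewrite !inE Phiz eqxx (negPf nzz) => /(_ isT).
  - split=> [a|sub]; first by rewrite !inE => /eqP ->; rewrite raddf0.
    by have := sub w; rewrite !inE Phiw.1 eqxx (negPf Phiw.2) => /(_ isT).
  split=> [a|sub]; first by rewrite !inE => /eqP ->; rewrite raddf0.
  by have := sub b; rewrite !inE Phib.2 eqxx (negPf Phib.1) => /(_ isT).
by have := dimB _ _ chain.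
Qed.

End Retract.

(** * Lueroth's theorem *)

Section MinimalPolynomial.
Variables (K : fieldType) (F : divringClosed K) (z : K).

Lemma minimal_annihilator (T0 : {poly K}) :
  T0 \is a polyOver F -> T0 != 0 -> root T0 z ->
  exists G : {poly K}, [/\ G \is a polyOver F, G != 0, root G z &
    forall T, T \is a polyOver F -> root T z -> G %| T].
Proof.
have [m] := ubnP (size T0); elim: m T0 => // m IHm T0 szT0 FT0 nzT0 T0z.
have [[T [FT nzT Tz szT]]|noT] := pselect (exists T : {poly K},
    [/\ T \is a polyOver F, T != 0, root T z & (size T < size T0)%N]).
  by apply: (IHm T) => //; apply: leq_trans szT _.
exists T0; split => // T; have [l] := ubnP (size T).
elim: l T => // l IHl T szT FT Tz.
have [->|nzT] := eqVneq T 0; first exact: dvdp0.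
have [ltT|leT] := ltnP (size T) (size T0); first by case: noT; exists T.
pose c := lead_coef T / lead_coef T0; pose j := (size T - size T0)%N.
have nzc : c != 0 by rewrite mulf_neq0 ?invr_eq0 ?lead_coef_eq0.
pose D := c *: (T0 * 'X^j).
have szD : size D = size T.
  by rewrite size_scale // size_mulXn // subnK.
have lcD : lead_coef D = lead_coef T.
  by rewrite lead_coefZ lead_coefM lead_coefXn mulr1 divfK ?lead_coef_eq0.
have FD : D \is a polyOver F.
  have Fc : c \in F by rewrite rpred_div // lead_coefE; apply: (polyOverP _).
  by rewrite polyOverZ // rpredM // rpredX // polyOverX.
rewrite -(subrK D T); apply: dvdp_add; last by rewrite dvdpZr // dvdp_mulr.
apply: IHl; rewrite ?rpredB //.
  have lt0 : (0 < size T)%N by rewrite size_poly_gt0.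
  suff : (size (T - D)%R < size T)%N by move=> /leq_trans; apply.
  rewrite -[ltnRHS](prednK lt0) ltnS; apply/leq_sizeP => i.
  rewrite leq_eqVlt => /orP[/eqP <-|lti].
    by rewrite coefB -lead_coefE -lcD lead_coefE szD subrr.
  by rewrite coefB !nth_default ?subrr ?szD // -(prednK lt0).
by rewrite rootE hornerD hornerN hornerZ hornerM (eqP Tz) (eqP T0z) mul0r mulr0 subrr.
Qed.

End MinimalPolynomial.

Lemma fraction_repr (k : fieldType) (x : {fraction {poly k}}) :
  exists p q : {poly k}, q != 0 /\ x = tofrac p / tofrac q.
Proof.
elim/quotW: x => r; exists r.1, r.2; split; first exact: denom_ratioP.
apply: (canRL (mulfK _)); first by rewrite tofrac_eq0 denom_ratioP.
rewrite !piE; apply/eqmodP; rewrite /= FracField.equivfE /=.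
by rewrite !numden_Ratio ?mulr1 ?oner_eq0 ?denom_ratioP // mulrC.
Qed.

(** Here k[s] is {poly k}, K stands for its field of fractions k(s), and
    frac for the inclusion. *)
Section RationalFunctions.
Variables (k : closedFieldType) (K : fieldType) (frac : {rmorphism {poly k} -> K}).
Hypothesis frac_inj : injective frac.
Hypothesis frac_repr : forall x, exists p q : {poly k}, q != 0 /\ x = frac p / frac q.
Implicit Types (T G H : {poly {poly k}}).

Lemma frac_eq0 (p : {poly k}) : (frac p == 0) = (p == 0).
Proof. by rewrite -(inj_eq frac_inj) rmorph0. Qed.

(** Polynomials in the outer variable X whose coefficients in k[s] have no
    common root. *)
Definition primitive G := forall a, map_poly (horner_eval a) G != 0.

Lemma horner_eval_eq0 T a :
  map_poly (horner_eval a) T = 0 -> exists H, T = ('X - a%:P)%:P * H.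
Proof.
move=> Ta0; exists (map_poly (fun c => c %/ ('X - a%:P)) T).
apply/polyP => i; rewrite coefCM coef_map_id0 ?div0p // mulrC divpK //.
by rewrite dvdp_XsubCl /root -[_.[a]]/(horner_eval a _) -coef_map Ta0 coef0.
Qed.

(** Gauss's lemma: a nonconstant denominator has a root a, and setting the
    inner variable to a shows that it divides the cofactor of a primitive
    polynomial. *)
Lemma gauss_cancel G T H (c : {poly k}) :
  primitive G -> c != 0 -> c%:P * T = G * H -> exists H', T = G * H'.
Proof.
move=> primG; have [m] := ubnP (size c); elim: m c H => // m IHm c H szc nzc eq.
have [sz1|/closed_rootP[a ca]] := boolP (size c == 1%N).
  have /size_poly1P[d nzd def_c] := sz1.
  exists (d^-1%:P%:P * H); rewrite mulrCA -eq def_c mulrA.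
  by rewrite -!rmorphM /= mulVf // mul1r.
have Ha : map_poly (horner_eval a) H = 0.
  have /(congr1 (map_poly (horner_eval a))) := eq.
  rewrite !rmorphM /= map_polyC /= /horner_eval (eqP ca) mul0r => /esym/eqP.
  by rewrite mulf_eq0 (negPf (primG a)) => /eqP.
have [H1 defH] := horner_eval_eq0 Ha.
have /factor_theorem[c1 def_c] := ca.
have nzc1 : c1 != 0 by apply: contraNneq nzc => c10; rewrite def_c c10 mul0r.
have nzX : ('X - a%:P : {poly k}) != 0 by rewrite polyXsubC_eq0.
apply: (IHm c1 H1) => //.
  by move: szc; rewrite def_c size_Mmonic ?monicXsubC // size_XsubC addn2.
apply: (mulfI (x := ('X - a%:P)%:P)); first by rewrite polyC_eq0.
by rewrite mulrA -rmorphM /= [_ * c1]mulrC -def_c eq defH mulrCA.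
Qed.

Lemma clear_denominators (G : {poly K}) :
  exists (c : {poly k}) G', c != 0 /\ map_poly frac G' = (frac c) *: G.
Proof.
elim/poly_ind: G => [|G x [c [G' [nzc defG']]]].
  by exists 1, 0; rewrite oner_eq0 map_poly0 scaler0.
have [p [q [nzq ->]]] := frac_repr x.
exists (c * q), (G' * 'X * q%:P + (c * p)%:P).
rewrite mulf_neq0 // rmorphD !rmorphM /= map_polyX !map_polyC /= defG'.
split=> //; rewrite scalerDr -!mul_polyC !rmorphM /= -!mulrA.
have qV : (frac q)%:P * ((frac q)^-1)%:P = 1 :> {poly K}.
  by rewrite -rmorphM /= divff ?frac_eq0.
move: qV; move: (_^-1)%:P (frac c)%:P (frac q)%:P (frac p)%:P => V C Q P QV.
by rewrite (mulrCA Q P) QV mulr1 (mulrCA Q G) (mulrC Q).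
Qed.

Lemma primitive_part G : G != 0 ->
  exists (d : {poly k}) G', [/\ d != 0, primitive G' & G = d%:P * G'].
Proof.
have [m] := ubnP (size (lead_coef G)).
elim: m G => // m IHm G szG nzG.
have [primG|] := pselect (primitive G).
  by exists 1, G; rewrite oner_eq0 mul1r.
move=> /existsNP[a /negP/negPn/eqP/horner_eval_eq0[G1 defG]].
have nzX : ('X - a%:P : {poly k}) != 0 by rewrite polyXsubC_eq0.
have nzG1 : G1 != 0 by apply: contraNneq nzG => G10; rewrite defG G10 mulr0.
have [|//|d [G' [nzd primG' defG1]]] := IHm G1.
  move: szG; rewrite defG lead_coefM lead_coefC size_mul ?lead_coef_eq0 //.
  by rewrite size_XsubC addSn.
exists (('X - a%:P) * d), G'; split=> //; first by rewrite mulf_neq0.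
by rewrite defG defG1 mulrA -rmorphM.
Qed.

Lemma map_frac_inj : injective (map_poly frac).
Proof. exact: map_inj_poly frac_inj (rmorph0 _). Qed.

Local Notation const := (frac \o polyC).
Implicit Types (p q v w : {poly k}).

(** The polynomial p(X) q(s) - q(X) p(s), which vanishes for X = s: up to a
    factor in k[s], the equation of X - s over a field containing p / q. *)
Definition diag p q : {poly {poly k}} := p^:P * q%:P - q^:P * p%:P.

Lemma coef_diag p q i : (diag p q)`_i = p`_i *: q - q`_i *: p.
Proof. by rewrite coefB !coefMC !coef_map /= !mul_polyC. Qed.

Lemma diag_outer p q a : (diag p q).[a%:P] = p.[a] *: q - q.[a] *: p.
Proof. by rewrite !hornerE !horner_map /= !mul_polyC. Qed.

Lemma diag_inner p q a :
  map_poly (horner_eval a) (diag p q) = q.[a] *: p - p.[a] *: q.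
Proof.
rewrite rmorphB !rmorphM /= !map_polyC /= -!map_poly_comp.
rewrite !map_poly_id ?[_ * _%:P]mulrC ?mul_polyC // => [x _|x _];
  by rewrite /= /horner_eval hornerC.
Qed.

Lemma swap_diag p q : swapXY (diag p q) = - diag p q.
Proof.
apply/polyP => i; apply/polyP => j.
rewrite coef_swapXY !coefN !coef_diag !coefB !coefZ opprB.
by rewrite [p`_i * _]mulrC [q`_i * _]mulrC.
Qed.

Lemma size_diag p q : (size (diag p q) <= maxn (size p) (size q))%N.
Proof.
apply/leq_sizeP => i; rewrite geq_max => /andP[szp szq].
by rewrite coef_diag !nth_default // !scale0r subrr.
Qed.

Lemma horner_lift p : (map_poly frac p^:P).[frac 'X] = frac p.
Proof. by rewrite horner_map /= -[_.['X]]/(p \Po 'X) comp_polyXr. Qed.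

Definition independent v w := forall a b : k, a *: v + b *: w = 0 -> a = 0 /\ b = 0.

Lemma diag_neq0 p q : q != 0 -> independent p q -> diag p q != 0.
Proof.
move=> nzq ind; apply: contraNneq nzq => D0.
have /(congr1 (fun r : {poly {poly k}} => r`_(size q).-1)) := D0.
rewrite coef_diag coef0 -lead_coefE addrC -scaleNr => /ind[/eqP].
by rewrite oppr_eq0 lead_coef_eq0.
Qed.

Section Generator.
Variable F : divringClosed K.
Hypothesis constF : forall c, const c \in F.

Let annihilator p q : {poly K} :=
  map_poly frac p^:P - (frac p / frac q) *: map_poly frac q^:P.

Lemma diag_annihilator p q : q != 0 ->
  map_poly frac (diag p q) = (frac q) *: annihilator p q.
Proof.
move=> nzq; rewrite rmorphB !rmorphM /= !map_polyC /= scalerBr scalerA.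
have -> : frac q * (frac p / frac q) = frac p.
  by rewrite mulrC divfK ?frac_eq0.
by rewrite -!mul_polyC; congr (_ - _); apply: mulrC.
Qed.

Lemma annihilator_over p q :
  frac p / frac q \in F -> annihilator p q \is a polyOver F.
Proof.
have over r : map_poly frac r^:P \is a polyOver F.
  by apply/polyOverP => i; rewrite !coef_map; apply: constF.
by move=> Fpq; apply: rpredB (over p) (polyOverZ Fpq (over q)).
Qed.

Lemma annihilator_root p q : q != 0 -> root (annihilator p q) (frac 'X).
Proof.
move=> nzq; rewrite rootE hornerD hornerN hornerZ !horner_lift divfK ?subrr //.
by rewrite frac_eq0.
Qed.

Lemma annihilator_neq0 p q : q != 0 ->
  (forall c, frac p / frac q != const c) -> annihilator p q != 0.
Proof.
move=> nzq /(_ (p`_(size q).-1 / lead_coef q)); apply: contraNneq => ann0.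
have nzl : const (lead_coef q) != 0 by rewrite frac_eq0 polyC_eq0 lead_coef_eq0.
have /(congr1 (fun r : {poly K} => r`_(size q).-1)) := ann0.
rewrite coefB coefZ coef0 !coef_map -lead_coefE.
move=> /eqP; rewrite subr_eq0 => /eqP eq.
by rewrite fmorph_div; apply/eqP/(canRL (mulfK nzl))/esym.
Qed.

(** G is the minimal polynomial of s over F, cleared of its denominators and of
    the common factors of its coefficients; hence it divides every diag p q with
    p / q in F, first over the field and then over k[s] by Gauss's lemma. *)
Lemma primitive_generator : (exists2 y, y \in F & forall c, y != const c) ->
  exists G : {poly {poly k}}, [/\ G != 0, primitive G,
    (map_poly frac G).[frac 'X] = 0,
    forall i, frac G`_i / frac (lead_coef G) \in F &
    forall p q, q != 0 -> frac p / frac q \in F -> exists H, diag p q = G * H].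
Proof.
case=> y; have [p0 [q0 [nzq0 ->]]] := frac_repr y => Fy y_nonconst.
have [G1 [FG1 nzG1 G1z G1min]] := minimal_annihilator (annihilator_over Fy)
  (annihilator_neq0 nzq0 y_nonconst) (annihilator_root p0 nzq0).
have [c [G2 [nzc defG2]]] := clear_denominators G1.
have nzfc : frac c != 0 by rewrite frac_eq0.
have nzG2 : G2 != 0.
  apply: contraNneq nzG1 => G20; have /eqP := defG2.
  by rewrite G20 map_poly0 eq_sym scaler_eq0 (negPf nzfc).
have [d [G [nzd primG defG]]] := primitive_part nzG2.
have nzfd : frac d != 0 by rewrite frac_eq0.
have GG1 : (frac d) *: map_poly frac G = (frac c) *: G1.
  by rewrite -defG2 defG rmorphM /= map_polyC /= mul_polyC.
have nzG : G != 0 by apply: contraNneq nzG2 => G0; rewrite defG G0 mulr0.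
exists G; split => //.
- have /(congr1 (fun r => r.[frac 'X])) := GG1.
  rewrite !hornerZ (eqP G1z) mulr0 => /eqP.
  by rewrite mulf_eq0 (negPf nzfd) => /eqP.
- move=> i; have coefG j : frac G`_j = (frac c / frac d) * G1`_j.
    have /(congr1 (fun r : {poly K} => r`_j)) := GG1.
    rewrite !coefZ coef_map /= => eq.
    by rewrite mulrAC -eq mulrAC divff ?mul1r.
  have nzcd : frac c / frac d != 0 by rewrite mulf_neq0 ?invr_eq0.
  rewrite lead_coefE !coefG -mulf_div divff // mul1r rpred_div //;
    exact: (polyOverP FG1).
move=> p q nzq Fpq.
have /dvdpP[M defM] := G1min _ (annihilator_over Fpq) (annihilator_root p nzq).
have [e [M' [nze defM']]] := clear_denominators ((frac q * frac d / frac c) *: M).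
apply: (gauss_cancel primG nze (H := M')); apply: map_frac_inj.
rewrite !rmorphM /= map_polyC /= diag_annihilator // defM' defM.
have -> : G1 = (frac d / frac c) *: map_poly frac G.
  by rewrite [frac d / _]mulrC -scalerA GG1 scalerA mulVf ?scale1r // frac_eq0.
rewrite mul_polyC -!scalerAr !scalerA [M * _]mulrC.
by congr (_ *: _); rewrite !mulrA.
Qed.

(** The core of Lueroth's theorem. Let v / w be a nonconstant coefficient of the
    minimal polynomial of s, in lowest terms. The primitive polynomial G divides
    diag v w, whose degree in s is at most that of G; so the cofactor only
    involves X, and it is constant because v and w are coprime. Thus diag v w is
    itself the minimal polynomial. *)
Lemma luroth_generator : (exists2 y, y \in F & forall c, y != const c) ->
  exists v w : {poly k}, [/\ coprimep v w, w != 0, independent v w,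
    frac v / frac w \in F &
    forall p q, q != 0 -> frac p / frac q \in F ->
      exists H, diag p q = diag v w * H].
Proof.
move=> /primitive_generator[G [nzG primG Gz FG dvdG]].
pose b := lead_coef G; have nzb : b != 0 by rewrite lead_coef_eq0.
have [i a_nonconst] : exists i, forall c, G`_i != c *: b.
  apply: contrapT => /forallNP allconst.
  have {}allconst i : exists c, G`_i = c *: b.
    have /existsNP[c /negP/negPn/eqP eq] := allconst i.
    by exists c.
  have [g gP] := choice allconst.
  have defG : G = b%:P * (\poly_(i < size G) g i)^:P.
    apply/polyP => i; rewrite coefCM coef_map coef_poly /=.
    case: ltnP => [_|szi]; last by rewrite polyC0 mulr0 nth_default.
    by rewrite mulrC mul_polyC.
  have /eqP := Gz; rewrite defG rmorphM /= map_polyC /= hornerM hornerC.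
  rewrite horner_lift mulf_eq0 !frac_eq0 (negPf nzb) /= => /eqP g0.
  by move: nzG; rewrite defG g0 map_poly0 mulr0 eqxx.
pose a := G`_i; pose g := gcdp a b.
pose v := a %/ g; pose w := b %/ g.
have nzg : g != 0 by rewrite gcdp_eq0 negb_and nzb orbT.
have def_a : a = v * g by rewrite divpK ?dvdp_gcdl.
have def_b : b = w * g by rewrite divpK ?dvdp_gcdr.
have nzw : w != 0 by apply: contraNneq nzb => w0; rewrite def_b w0 mul0r.
have cop : coprimep v w by rewrite coprimep_div_gcd // nzb orbT.
have ind : independent v w.
  move=> al be; have [->|nzal] := eqVneq al 0.
    rewrite scale0r add0r => /eqP; rewrite scaler_eq0 (negPf nzw) orbF.
    by move/eqP.
  move=> eq; have /negP[] := a_nonconst (- be / al).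
  rewrite -[G`_i]/a def_a -/b def_b scalerAl mulrC [_ * g]mulrC; apply/eqP; congr (_ * _).
  apply: (scalerI nzal); rewrite scalerA mulrC divfK // scaleNr.
  by apply/eqP; rewrite -addr_eq0 eq.
have Fvw : frac v / frac w \in F.
  have -> : frac v / frac w = frac a / frac b; last exact: FG.
  rewrite def_a def_b !rmorphM /= -mulf_div [frac g / _]divff ?mulr1 //.
  by rewrite frac_eq0.
have [H defH] := dvdG _ _ nzw Fvw.
have nzD := diag_neq0 nzw ind.
have nzH : H != 0 by apply: contraNneq nzD => H0; rewrite defH H0 mulr0.
have szH : (size (swapXY H) <= 1)%N.
  have := size_diag v w; rewrite -size_polyN -swap_diag defH rmorphM /=.
  rewrite size_mul ?swapXY_eq0 // -!sizeYE.
  have : (maxn (size v) (size w) <= sizeY G)%N.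
    have sza : (size a <= sizeY G)%N by apply: max_size_coefXY.
    have szb : (size b <= sizeY G)%N by apply: max_size_lead_coefXY.
    rewrite geq_max; apply/andP; split.
      by apply: leq_trans sza; rewrite leq_divp.
    by apply: leq_trans szb; rewrite leq_divp.
  have : (0 < sizeY G)%N by rewrite lt0n sizeY_eq0.
  by move: (sizeY G) (sizeY H) (maxn _ _) => l m n; lia.
have [h defh] : exists h, H = h^:P.
  exists (swapXY H)`_0; rewrite -swapXY_polyC -(size1_polyC szH).
  by rewrite swapXYK.
have /size_poly1P[c nzc def_c] : size h == 1%N.
  apply: contrapT => /negP/closed_rootP[r hr].
  have := diag_outer v w r.
  rewrite defH hornerM defh horner_map (eqP hr) /= mulr0.
  move=> /esym; rewrite addrC -scaleNr => /ind[/eqP].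
  rewrite oppr_eq0 coprimep_sym in cop * => wr /eqP.
  by rewrite (negPf (coprimep_root cop wr)).
exists v, w; split=> // p q nzq /(dvdG _ _ nzq)[M defM].
exists (c^-1%:P%:P * M); rewrite defH defh def_c map_polyC defM -mulrA.
congr (_ * _); rewrite /= mulrA -!rmorphM /= divff ?mul1r //.
Qed.

Section Pencil.
Variables v w : {poly k}.
Hypothesis dvd_diag : forall p q, q != 0 -> frac p / frac q \in F ->
  exists H, diag p q = diag v w * H.

(** Every p / q in F in lowest terms has its numerator divisible by a member of
    the pencil spanned by v and w: the one through a root of p, or, if p is
    constant, the one through the point at infinity, which shows up as the
    leading coefficient of diag v w. *)
Lemma pencil_factor p q : p != 0 -> q != 0 -> coprimep p q ->
    frac p / frac q \in F -> (size p != 1%N) || (size q != 1%N) ->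
  exists a b : k, [/\ a *: v + b *: w != 0, (a *: v + b *: w) %| p &
    size p != 1%N -> size (a *: v + b *: w) != 1%N].
Proof.
move=> nzp nzq cop Fpq szpq; have [H defH] := dvd_diag nzq Fpq.
have [szp1|szp1] := boolP (size p == 1%N).
  have {szpq} szq1 : size q != 1%N by rewrite szp1 in szpq.
  have szq : (1 < size q)%N by rewrite ltn_neqAle eq_sym szq1 size_poly_gt0.
  have /size_poly1P[c nzc def_p] := szp1.
  have lead_pq : lead_coef (diag p q) = - (lead_coef q * c)%:P.
    have szqP : size q^:P = size q by apply: size_map_inj_poly (@polyC_inj k) _ _.
    rewrite /diag def_p map_polyC -rmorphM /= addrC lead_coefDl.
      rewrite lead_coefN lead_coefM lead_coefC rmorphM /=.
      by rewrite (lead_coef_map_inj (@polyC_inj k)).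
    rewrite size_polyN size_mul ?map_polyC_eq0 ?polyC_eq0 // szqP size_polyC.
    rewrite size_polyC polyC_eq0 nzc addn1 /=.
    by apply: leq_ltn_trans szq; rewrite leq_b1.
  exists (- w`_(size (diag v w)).-1), v`_(size (diag v w)).-1.
  have -> : - w`_(size (diag v w)).-1 *: v + v`_(size (diag v w)).-1 *: w =
            lead_coef (diag v w).
    by rewrite lead_coefE coef_diag addrC scaleNr.
  have lead_dvd : lead_coef (diag v w) %| p.
    rewrite def_p; apply: dvdp_trans (_ : (- (lead_coef q * c))%:P %| _).
      by rewrite rmorphN -lead_pq defH lead_coefM dvdp_mulr.
    apply/dvdpP; exists (c / - (lead_coef q * c))%:P.
    by rewrite -rmorphM /= divfK // oppr_eq0 mulf_neq0 ?lead_coef_eq0.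
  by split=> //; apply: contraNneq nzp => l0; rewrite -dvd0p -l0.
have /closed_rootP[a pa] := szp1.
have qa := coprimep_root cop pa.
have /(congr1 (map_poly (horner_eval a))) := defH.
rewrite rmorphM /= !diag_inner (eqP pa) scale0r subr0 => eq.
have nzl : w.[a] *: v - v.[a] *: w != 0.
  apply: contraNneq nzp => l0; rewrite l0 mul0r in eq.
  by move/eqP: eq; rewrite scaler_eq0 (negPf qa).
exists w.[a], (- v.[a]); rewrite scaleNr; split=> // [|_].
  by rewrite -(dvdpZr _ _ qa) eq dvdp_mulr.
apply/closed_rootP; exists a.
by rewrite rootE hornerD hornerN !hornerZ mulrC subrr.
Qed.

Let u := frac v / frac w.
Hypothesis nzw : w != 0.
Hypothesis Fu : u \in F.

Let nzfw : frac w != 0. Proof. by rewrite frac_eq0. Qed.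

Let horner_linear (a b : k) :
  (map_poly const (a *: 'X + b%:P)).[u] = const a * u + const b.
Proof. by rewrite rmorphD /= map_polyZ map_polyX map_polyC !hornerE. Qed.

Lemma frac_pencil (a b : k) :
  frac (a *: v + b *: w) = frac w * (map_poly const (a *: 'X + b%:P)).[u].
Proof.
rewrite horner_linear -!mul_polyC rmorphD !rmorphM mulrDr mulrCA.
by rewrite [frac w * u]mulrC divfK // [frac w * _]mulrC.
Qed.

Lemma pencil_over (a b : k) : frac (a *: v + b *: w) / frac w \in F.
Proof.
rewrite frac_pencil horner_linear mulrC mulKf //.
exact: rpredD (rpredM (constF a) Fu) (constF b).
Qed.

(** Dividing p and q by members of the pencil divides p / q by a fraction of
    degree 1 in v / w, and decreases the degrees. *)
Lemma rational_in_generator p q : p != 0 -> q != 0 -> coprimep p q ->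
    frac p / frac q \in F ->
  exists P Q, (map_poly const Q).[u] != 0 /\
    frac p / frac q = (map_poly const P).[u] / (map_poly const Q).[u].
Proof.
have [m] := ubnP (size p + size q)%N.
elim: m p q => // m IHm p q szm nzp nzq cop Fpq.
have [szpq|] := boolP ((size p != 1%N) || (size q != 1%N)); last first.
  rewrite negb_or !negbK => /andP[/size_poly1P[c nzc ->] /size_poly1P[d nzd ->]].
  exists c%:P, d%:P; rewrite !map_polyC !hornerC.
  by rewrite frac_eq0 polyC_eq0.
have [a [b [nzl lp szl]]] := pencil_factor nzp nzq cop Fpq szpq.
have [a' [b' [nzl' lq szl']]] : exists a b : k,
    [/\ a *: v + b *: w != 0, (a *: v + b *: w) %| q &
    size q != 1%N -> size (a *: v + b *: w) != 1%N].
  apply: (pencil_factor (q := p)); rewrite // 1?coprimep_sym 1?orbC //.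
  by rewrite -invf_div rpredV.
have /dvdpP[p1 def_p] := lp; have /dvdpP[q1 def_q] := lq.
move: (frac_pencil a b) (frac_pencil a' b') (pencil_over a b) (pencil_over a' b').
set l := a *: v + b *: w in nzl lp szl def_p *.
set l' := a' *: v + b' *: w in nzl' lq szl' def_q *.
move=> fl fl' Fl Fl'.
have [nzp1 nzq1] : p1 != 0 /\ q1 != 0.
  by split; [move: nzp | move: nzq]; rewrite (def_p, def_q) mulf_eq0 negb_or => /andP[].
have nzfl : frac l != 0 by rewrite frac_eq0.
have nzfl' : frac l' != 0 by rewrite frac_eq0.
have eq1 : frac p / frac q = (frac p1 / frac q1) * (frac l / frac l').
  by rewrite def_p def_q !rmorphM mulf_div.
have eql : frac l / frac l' = (frac l / frac w) / (frac l' / frac w).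
  by rewrite invf_div mulrA divfK.
have [||||P [Q [nzQ eqPQ]]] := IHm p1 q1 _ nzp1.
- move: szm szpq szl szl'; rewrite def_p def_q !size_mul //.
  have := nzp1; have := nzq1; have := nzl; have := nzl'.
  rewrite -!size_poly_gt0.
  move: (size p1) (size q1) (size l) (size l') => x y z t; clear.
  by case: z => [|[|z]] //; case: t => [|[|t]] //; lia.
- exact: nzq1.
- by move: cop; rewrite def_p def_q coprimepMl coprimepMr => /andP[/andP[]].
- have -> : frac p1 / frac q1 = (frac p / frac q) / (frac l / frac l').
    by rewrite eq1 mulfK // mulf_neq0 // invr_eq0.
  by rewrite rpred_div // eql rpred_div.
exists (P * (a *: 'X + b%:P)), (Q * (a' *: 'X + b'%:P)).
rewrite !(rmorphM (map_poly const)) !hornerM eq1 eqPQ fl fl'; split.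
  by rewrite mulf_neq0 //; move: nzfl'; rewrite fl' mulf_eq0 negb_or => /andP[].
by rewrite -[in LHS]mulf_div divff // mul1r mulf_div.
Qed.
End Pencil.

Theorem luroth : (exists2 y, y \in F & forall c, y != const c) ->
  exists u, [/\ u \in F, forall c, u != const c &
    forall y, y \in F -> exists P Q, (map_poly const Q).[u] != 0 /\
      y = (map_poly const P).[u] / (map_poly const Q).[u]].
Proof.
move=> /luroth_generator[v [w [cop nzw ind Fvw dvdD]]].
have nzfw : frac w != 0 by rewrite frac_eq0.
exists (frac v / frac w); split=> // [c|y Fy].
  apply/eqP => /(canRL (divfK nzfw)); rewrite /= -rmorphM => /frac_inj eq.
  have [|/eqP] := ind 1 (- c); last by rewrite oner_eq0.
  by rewrite scale1r scaleNr -mul_polyC eq subrr.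
have [p [q [nzq def_y]]] := frac_repr y.
have [p0|nzp] := eqVneq p 0.
  exists 0, 1; rewrite def_y p0 !rmorph0 rmorph1 hornerC horner0 oner_eq0.
  by rewrite !mul0r.
pose g := gcdp p q.
have nzg : g != 0 by rewrite gcdp_eq0 negb_and nzp.
have def_p : p = (p %/ g) * g by rewrite divpK ?dvdp_gcdl.
have def_q : q = (q %/ g) * g by rewrite divpK ?dvdp_gcdr.
have eq : y = frac (p %/ g) / frac (q %/ g).
  rewrite def_y [in LHS]def_p [in LHS]def_q !rmorphM -mulf_div.
  by rewrite [frac g / _]divff ?mulr1 // frac_eq0.
rewrite eq; apply: (rational_in_generator dvdD) => //.
- by apply: contraNneq nzp => p0; rewrite def_p p0 mul0r.
- by apply: contraNneq nzq => q0; rewrite def_q q0 mul0r.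
- by rewrite coprimep_div_gcd // nzp.
by rewrite -eq.
Qed.

End Generator.
End RationalFunctions.

(** * The algebra as a subalgebra of k[s][t] *)

(** Used to invert embeddings in k[s][t] and substitutions on their images. *)
Lemma lift_rmorphism (A C E : nzRingType) (phi : {rmorphism A -> E}) (tau : {rmorphism C -> E}) :
    injective tau -> (forall a, exists c, tau c = phi a) ->
  exists psi : {rmorphism A -> C}, forall a, tau (psi a) = phi a.
Proof.
move=> tau_inj /choice[psi psiE].
have psiB : zmod_morphism psi.
  by move=> a b; apply: tau_inj; rewrite rmorphB !psiE rmorphB.
have psiM : monoid_morphism psi.
  split=> [|a b]; apply: tau_inj; rewrite ?psiE ?rmorph1 //.
  by rewrite !rmorphM !psiE.
pose psi' : {rmorphism A -> C} := HB.pack psi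
  (GRing.isZmodMorphism.Build A C psi psiB) (GRing.isMonoidMorphism.Build A C psi psiM).
by exists psi'.
Qed.

Section CurveEmbedding.
Variables (k : closedFieldType) (B : gradedAlg k).
Local Notation kst := {poly {poly k}}.
Implicit Types (b : B).

Lemma scaleXn_inj (D : idomainType) d : injective (fun p : D => p *: 'X^d : {poly D}).
Proof.
move=> p q /(congr1 (fun r : {poly D} => r`_d)).
by rewrite !coefZ coefXn eqxx !mulr1.
Qed.

Variable Phi : {rmorphism B -> kst}.
Hypothesis PhiP : curve_embedding Phi.

(** Degrees can be read off the image: the components of b of other degrees have
    image 0. *)
Lemma embedding_hcomp d b p : Phi b = p *: 'X^d -> b \in hcomp B d.
Proof.
have [inj _ grad] := PhiP => bE.
have [N [c [cd bsum]]] := hcomp_sum b.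
have [q qE] := choice (fun i => grad i _ (cd i)).
have Phi_coef j : (Phi b)`_j = if (j < N)%N then q j else 0.
  rewrite bsum raddf_sum coef_sum.
  have term i : (Phi (c i))`_j = if j == i then q i else 0.
    by rewrite qE coefZ coefXn; case: ifP => _; rewrite ?mulr1 ?mulr0.
  case: ltnP => [jN|Nj].
    rewrite (bigD1 (Ordinal jN)) //= term eqxx big1 ?addr0 // => i.
    by rewrite term -val_eqE eq_sym /= => /negPf ->.
  by rewrite big1 // => i _; rewrite term gtn_eqF // (leq_trans _ Nj).
have cj j : (j < N)%N -> j != d -> c j = 0.
  move=> jN jd; apply: inj; rewrite raddf0 qE.
  have := Phi_coef j; rewrite jN bE coefZ coefXn (negPf jd) mulr0 => <-.
  by rewrite scale0r.
rewrite bsum; have [dN|Nd] := ltnP d N.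
  rewrite (bigD1 (Ordinal dN)) //= big1 ?addr0 // => i.
  by rewrite -val_eqE /=; apply: cj.
rewrite big1 ?hcomp0 // => i _; apply: cj => //.
by rewrite ltn_eqF // (leq_trans _ Nd).
Qed.

(** The sections of O(d) on the curve that come from B, in the coordinate s. *)
Definition in_image d p := exists2 b, b \in hcomp B d & Phi b = p *: 'X^d.

Lemma in_imageD d p q : in_image d p -> in_image d q -> in_image d (p + q).
Proof.
move=> [b bd bE] [b' b'd b'E]; exists (b + b'); first exact: hcompD.
by rewrite rmorphD bE b'E scalerDl.
Qed.

Lemma in_imageZ d c p : in_image d p -> in_image d (c *: p).
Proof.
have [_ PhiZ _] := PhiP.
move=> [b bd bE]; exists (c *: b); first exact: hcompZ.
by rewrite PhiZ bE mul_polyC scalerA mul_polyC.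
Qed.

Lemma in_imageB d p q : in_image d p -> in_image d q -> in_image d (p - q).
Proof. by move=> Wp Wq; rewrite -scaleN1r; apply/in_imageD/in_imageZ. Qed.

Lemma in_image0 d : in_image d 0.
Proof. by exists 0; [exact: hcomp0 | rewrite raddf0 scale0r]. Qed.

Lemma in_image1 : in_image 0 1.
Proof. by exists 1; [exact: hcomp1 | rewrite rmorph1 scale1r]. Qed.

Lemma in_image_const c : in_image 0 c%:P.
Proof. by rewrite -alg_polyC; apply/in_imageZ/in_image1. Qed.

Lemma in_image_sum d (I : finType) (F : I -> {poly k}) :
  (forall i, in_image d (F i)) -> in_image d (\sum_i F i).
Proof.
by move=> WF; elim/big_rec: _ => [|i p _ Wp]; [exact: in_image0 | exact: in_imageD].
Qed.

Lemma in_imageM d d' p q : in_image d p -> in_image d' q -> in_image (d + d') (p * q).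
Proof.
move=> [b bd bE] [b' b'd b'E]; exists (b * b'); first exact: hcompM.
by rewrite rmorphM bE b'E -scalerAl -scalerAr scalerA exprD.
Qed.

Lemma in_imageX d p m : in_image d p -> in_image (d * m) (p ^+ m).
Proof.
move=> Wp; elim: m => [|m IHm]; first by rewrite muln0; apply: in_image1.
by rewrite mulnS exprS; apply: in_imageM.
Qed.

End CurveEmbedding.

Lemma lift_lrmorphism (k : closedFieldType) (A C : gradedAlg k)
    (phi : {rmorphism A -> {poly {poly k}}}) (tau : {rmorphism C -> {poly {poly k}}}) :
    curve_embedding phi -> curve_embedding tau -> (forall a, exists c, tau c = phi a) ->
  exists psi : {lrmorphism A -> C}, homogeneous psi /\ forall a, tau (psi a) = phi a.
Proof.
move=> [phi_inj phiZ phi_grad] tauP lift.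
have [tau_inj tauZ _] := tauP.
have [psi psiE] := lift_rmorphism tau_inj lift.
have psiZ : scalable psi by move=> c a; apply: tau_inj; rewrite tauZ !psiE phiZ.
pose psi' : {lrmorphism A -> C} := HB.pack (psi : A -> C)
  (GRing.RMorphism.on psi) (GRing.isScalable.Build k A C *:%R psi psiZ).
exists psi'; split=> // d a ad; have [p pE] := phi_grad d a ad.
by apply: (embedding_hcomp tauP (p := p)); rewrite psiE.
Qed.

Section Reparametrization.
Variables (k : closedFieldType) (K : fieldType) (frac : {rmorphism {poly k} -> K}).
Hypothesis frac_inj : injective frac.
Local Notation kst := {poly {poly k}}.
Local Notation const := (frac \o polyC).
Local Notation ev u := (horner_eval u \o map_poly const).

(** A polynomial relation for u splits into linear factors, one of which makes
    u constant. *)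
Lemma transcendental u : (forall c, u != const c) -> injective (ev u).
Proof.
move=> u_nonconst; suff ker p : ev u p = 0 -> p = 0 by apply: raddf_inj ker.
have [n] := ubnP (size p); elim: n p => // n IHn p szp pu.
have [sz1|/closed_rootP[a pa]] := boolP (size p == 1%N).
  have /size_poly1P[c nzc pE] := sz1; move: pu.
  rewrite pE /= map_polyC /horner_eval hornerC => c0.
  have : const c == 0 by apply/eqP.
  by rewrite fmorph_eq0 (negPf nzc).
have /factor_theorem[q pE] := pa.
suff q0 : q = 0 by rewrite pE q0 mul0r.
have [//|nzq] := eqVneq q 0; apply: IHn.
  by move: szp; rewrite pE size_Mmonic ?monicXsubC // size_XsubC addn2.
move: pu; rewrite pE rmorphM => /eqP; rewrite mulf_eq0 => /orP[/eqP //|].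
rewrite /= rmorphB /= map_polyX map_polyC /horner_eval hornerXsubC subr_eq0.
by rewrite (negPf (u_nonconst a)).
Qed.

(** The substitution s := u, t := h t. *)
Definition substitution (u h : K) : {rmorphism kst -> {poly K}} :=
  comp_poly (h *: 'X) \o map_poly (ev u).

Lemma comp_poly_scaleX (h : K) (p : {poly K}) i : (p \Po (h *: 'X))`_i = p`_i * h ^+ i.
Proof.
rewrite comp_polyE coef_sum.
have [lt_i|ge_i] := ltnP i (size p); last first.
  rewrite nth_default // mul0r big1 // => j _.
  by rewrite exprZn !coefZ coefXn gtn_eqF ?mulr0 // (leq_trans _ ge_i).
rewrite (bigD1 (Ordinal lt_i)) //= big1 ?addr0 => [|j]; rewrite exprZn !coefZ coefXn.
  by rewrite eqxx mulr1.
by rewrite -val_eqE eq_sym /= => /negPf ->; rewrite !mulr0.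
Qed.

Lemma coef_substitution u h (T : kst) i : (substitution u h T)`_i = ev u T`_i * h ^+ i.
Proof. by rewrite /substitution /= comp_poly_scaleX coef_map. Qed.

Lemma substitution_inj u h : (forall c, u != const c) -> h != 0 -> injective (substitution u h).
Proof.
move=> u_nonconst nzh T T' eq; apply/polyP => i.
have /(congr1 (fun p : {poly K} => p`_i)) := eq.
rewrite !coef_substitution => /(mulIf (expf_neq0 i nzh)).
exact: transcendental.
Qed.

Variables (B : gradedAlg k) (Phi : {rmorphism B -> kst}).
Hypothesis PhiP : curve_embedding Phi.
Hypothesis B_ind : generated_in_degree1 B.

Lemma substitution_scale u h d (p : {poly k}) :
  substitution u h (p *: 'X^d) = (ev u p * h ^+ d) *: 'X^d.
Proof.
apply/polyP => i; rewrite coef_substitution !coefZ !coefXn.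
by case: eqP => [->|_]; rewrite ?mulr1 // !mulr0 rmorph0 mul0r.
Qed.

(** The elements of degree 1, hence all of B, take values in the image of the
    substitution, which is isomorphic to k[s][t]. *)
Lemma reparametrize u h : (forall c, u != const c) -> h != 0 ->
    (forall b, b \in hcomp B 1 -> exists p Q, Phi b = p *: 'X /\ frac p = ev u Q * h) ->
  exists Psi : {rmorphism B -> kst}, curve_embedding Psi /\
    forall b, substitution u h (Psi b) = map_poly frac (Phi b).
Proof.
move=> u_nonconst nzh Phi1; have [Phi_inj PhiZ Phi_grad] := PhiP.
have s_inj := substitution_inj u_nonconst nzh.
have sC (c : k) : substitution u h c%:P%:P = (const c)%:P.
  by rewrite -[c%:P%:P]alg_polyC -[1](expr0 'X) substitution_scale /= map_polyC
    /horner_eval hornerC !expr0 mulr1 alg_polyC.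
have [|Psi PsiE] := @lift_rmorphism _ _ _ (map_poly frac \o Phi) _ s_inj.
  apply: B_ind => [c|b b' [T TE] [T' TE']|b b' [T TE] [T' TE']|b /Phi1[p [Q [bE pE]]]].
  - by exists c%:P%:P; rewrite sC /= PhiZ rmorph1 mulr1 map_polyC.
  - by exists (T + T'); rewrite !rmorphD TE TE'.
  - by exists (T * T'); rewrite !rmorphM TE TE'.
  exists (Q *: 'X^1); rewrite substitution_scale expr1 -pE /= bE.
  by rewrite map_polyZ map_polyX expr1.
exists Psi; split; last exact: PsiE.
split=> [b b' eq|c b|d b bd].
- apply: Phi_inj; apply: (map_inj_poly frac_inj (rmorph0 _)).
  by rewrite -[LHS]PsiE -[RHS]PsiE eq.
- by apply: s_inj; rewrite rmorphM sC !PsiE /= PhiZ rmorphM /= map_polyC.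
have [p bE] := Phi_grad d b bd.
exists (Psi b)`_d; apply/polyP => i; rewrite coefZ coefXn.
case: eqP => [->|/eqP id]; rewrite ?mulr1 // mulr0.
have bi : (map_poly frac (Phi b))`_i = 0.
  by rewrite bE coef_map coefZ coefXn (negPf id) mulr0 /= rmorph0.
have /esym/eqP := coef_substitution u h (Psi b) i.
rewrite PsiE [X in _ == X]bi mulf_eq0 expf_eq0 (negPf nzh) andbF orbF => /eqP eq.
by apply: (transcendental u_nonconst); rewrite eq rmorph0.
Qed.

End Reparametrization.

(** * Recovering all the forms of a given degree *)

(** The ideal generated by the P i is principal, generated by any nonzero element
    of least degree. *)
Lemma poly_bezout (k : fieldType) (N : nat) (P : 'I_N -> {poly k}) :
    (exists i, P i != 0) ->
  exists (G : {poly k}) (P' a : 'I_N -> {poly k}),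
    [/\ G != 0, forall i, P i = P' i * G & \sum_i a i * P' i = 1].
Proof.
case=> i0 nzP.
pose ideal p := exists a : 'I_N -> {poly k}, p = \sum_i a i * P i.
have idealP i : ideal (P i).
  exists (fun j => (j == i)%:R); rewrite (bigD1 i) //= eqxx mul1r big1 ?addr0 //.
  by move=> j /negPf ->; rewrite mul0r.
have exn : exists n, `[< exists p, [/\ ideal p, p != 0 & size p = n] >].
  by exists (size (P i0)); apply/asboolP; exists (P i0).
have [n /asboolP[G [[a GE] nzG szG]] nmin] := ex_minnP exn.
have dvdG i : G %| P i.
  rewrite /dvdp; apply: contraT => nzr.
  have := ltn_modp (P i) G; rewrite nzG ltnNge => /negP[].
  rewrite szG; apply: nmin; apply/asboolP; exists (P i %% G); split=> //.
  have [b PE] := idealP i; exists (fun j => b j - (P i %/ G) * a j).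
  have -> : P i %% G = P i - P i %/ G * G by rewrite {2}(divp_eq (P i) G) addrC addKr.
  rewrite {1}PE {2}GE mulr_sumr -sumrB; apply: eq_bigr => j _.
  by rewrite mulrBl mulrA.
exists G, (fun i => P i %/ G), a; split=> // [i|]; first by rewrite divpK.
apply: (mulIf nzG); rewrite mul1r mulr_suml [RHS]GE; apply: eq_bigr => i _.
by rewrite -mulrA divpK.
Qed.

Section Veronese.
Variables (k : closedFieldType) (B : gradedAlg k).
Local Notation kst := {poly {poly k}}.
Hypothesis B_integral : degree1_integrally_closed B.

(** For N > 0 the image is, with k[s] seen as k[x,y] dehomogenized, the Veronese
    subring of the forms whose degrees are multiples of N - 1; for N = 0 it
    is k. *)
Definition veronese_embedding (Psi : {rmorphism B -> kst}) := exists N : nat,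
  (forall b, b \in hcomp B 1 ->
    exists2 p : {poly k}, (size p <= N)%N & Psi b = p *: 'X) /\
  (forall j, (j < N)%N -> exists2 b, b \in hcomp B 1 & Psi b = 'X^j *: 'X).

Variable Psi : {rmorphism B -> kst}.
Hypothesis PsiP : curve_embedding Psi.
Local Notation W := (in_image Psi).

Variables (N : nat) (P a : 'I_N -> {poly k}).
Hypothesis WP : forall i, W 1 (P i).
Hypothesis P_span : forall p, W 1 p -> exists c : 'I_N -> k, p = \sum_i c i *: P i.
Hypothesis P_unimodular : \sum_i a i * P i = 1.

(** Divide p by a P j of maximal degree c: the quotient has degree at most r, and
    the remainder is dealt with by the relation \sum_i a i * P i = 1, at the
    cost of degrees bounded independently of p. *)
Lemma multiply_onto : exists c r0 : nat,
  (forall p, W 1 p -> (size p <= c.+1)%N) /\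
  forall r (p : {poly k}), (r0 <= r)%N -> (size p <= (r + c).+1)%N ->
    exists2 q : 'I_N -> {poly k}, (forall i, (size (q i) <= r.+1)%N) & p = \sum_i q i * P i.
Proof.
have [i0 nzP] : exists i, P i != 0.
  apply: contrapT => /forallNP P0; have /eqP := P_unimodular.
  rewrite big1 ?(eq_sym 0) ?oner_eq0 // => i _.
  by have /negP/negPn/eqP -> := P0 i; rewrite mulr0.
have [j szP] : exists j, forall i, (size (P i) <= size (P j))%N.
  have [j _ jmax] := @arg_maxnP _ i0 predT (fun i => size (P i)) isT.
  by exists j => i; apply: jmax.
have szj : (0 < size (P j))%N by apply: leq_trans (szP i0); rewrite size_poly_gt0.
have nzPj : P j != 0 by rewrite -size_poly_gt0.
pose c := (size (P j)).-1; have cE : size (P j) = c.+1 by rewrite prednK.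
exists c, (\max_i size (a i) + c)%N; split=> [p /P_span[z ->]|r p r0 szp].
  apply: leq_trans (size_sum _ _ _) _; apply/bigmax_leqP => i _.
  by rewrite -cE; apply: leq_trans (size_scale_leq _ _) (szP i).
pose q := p %/ P j; pose s := p %% P j.
have szs : (size s <= c)%N by rewrite -ltnS -cE ltn_modp.
exists (fun i => a i * s + (i == j)%:R * q) => [i|].
  have szas : (size (a i * s)%R <= r.+1)%N.
    apply: leq_trans (size_polyMleq _ _) _.
    have : (size (a i) <= \max_i size (a i))%N by apply: leq_bigmax.
    by move: r0 szs; move: (size _) (size s) (\max_i _) => x y z; lia.
  apply: leq_trans (size_polyD _ _) _; rewrite geq_max szas /=.
  case: (i == j); last by rewrite mul0r size_poly0.
  by rewrite mul1r size_divp // cE /=; move: szp; move: (size p) => x; lia.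
under eq_bigr do rewrite mulrDl.
rewrite big_split /= [X in _ + X](bigD1 j) //= eqxx mul1r.
rewrite [X in _ + (_ + X)]big1 => [|i /negPf ->]; last by rewrite !mul0r.
rewrite addr0 [LHS](divp_eq p (P j)) addrC; congr (_ + _).
rewrite -[LHS]mulr1 -P_unimodular mulr_sumr; apply: eq_bigr => i _.
by rewrite mulrCA mulrA.
Qed.

(** The coordinate s is a fraction of degree 0 of B. *)
Hypothesis B_fraction : exists d p, p != 0 /\ W d p /\ W d ('X * p).

(** If p and s p both come from B, in degree d, then del = p^r satisfies
    del k[s]_(<= r) in W; multiplying by the P i repeatedly, del k[s]_(<= r + m c)
    in W for all m. So del, in degree D, is a common denominator of the powers of
    all the s^j t for j <= c, which are therefore almost integral. *)
Lemma veronese : veronese_embedding Psi.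
Proof.
have [Psi_inj PsiZ Psi_grad] := PsiP.
have [c [r [szW onto]]] := multiply_onto.
have [d [p [nzp [Wp WXp]]]] := B_fraction.
pose del := p ^+ r; pose D := (d * r)%N.
have nzdel : del != 0 by rewrite expf_neq0.
have W_mono i : (i <= r)%N -> W D (del * 'X^i).
  move=> ir; have -> : del * 'X^i = ('X * p) ^+ i * p ^+ (r - i).
    by rewrite exprMn -mulrA -exprD subnKC // mulrC.
  by have := in_imageM (in_imageX i WXp) (in_imageX (r - i) Wp); rewrite -mulnDr subnKC.
have W_del m (q : {poly k}) : (size q <= (r + m * c).+1)%N -> W (m + D) (del * q).
  elim: m q => [|m IHm] q szq.
    rewrite -[q]coefK poly_def mulr_sumr; apply: in_image_sum => i.
    rewrite -scalerAr; apply: (in_imageZ PsiP); apply: W_mono.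
    by have := leq_trans (ltn_ord i) szq; rewrite mul0n addn0 ltnS.
  have [|z szz ->] := onto (r + m * c)%N q (leq_addr _ _).
    by move: szq; rewrite mulSn -addnA [(m * c + c)%N]addnC.
  rewrite mulr_sumr; apply: in_image_sum => i.
  by rewrite mulrA mulrC; apply: in_imageM (WP i) (IHm _ (szz i)).
exists c.+1; split=> [b b1|j jc].
  have [q bE] := Psi_grad 1%N b b1.
  by exists q => //; apply: szW; exists b.
have /choice[x xP] m : exists y, y \in hcomp B (m + D) /\ Psi y = (del * 'X^(j * m)) *: 'X^(m + D).
  have [|y yD yE] := W_del m 'X^(j * m); last by exists y.
  by rewrite size_polyXn ltnS mulnC (leq_trans _ (leq_addl _ _)) // leq_mul2l -ltnS jc orbT.
have [||e e1 eE] := @B_integral (x 1%N) (x 0%N).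
- apply: contraNneq nzdel => x0; have [_] := xP 0%N.
  rewrite x0 raddf0 muln0 expr0 mulr1 => eq.
  by apply/eqP/(@scaleXn_inj _ (0 + D)); rewrite -eq scale0r.
- exists D, x; split=> m; first by have [] := xP m.
  apply: Psi_inj; rewrite !rmorphM !rmorphXn /=.
  have [_ ->] := xP m; have [_ ->] := xP 1%N; have [_ ->] := xP 0%N.
  rewrite muln0 muln1 expr0 mulr1 add0n !exprZn -!scalerAl -!scalerAr !scalerA.
  congr (_ *: _); first by rewrite exprMn [in RHS]exprM mulrCA.
  rewrite -!exprM -!exprD mulnDl mul1n; congr (_ ^+ _).
  by rewrite addnA addnC [(D + m)%N]addnC.
exists e => //; have [q qE] := Psi_grad 1%N e e1; rewrite qE expr1; congr (_ *: _).
have := congr1 Psi eE; rewrite rmorphM qE; have [_ ->] := xP 1%N; have [_ ->] := xP 0%N.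
rewrite muln0 muln1 expr0 mulr1 add0n -scalerAl -scalerAr scalerA -exprD addnC.
by move=> /scaleXn_inj/(mulfI nzdel).
Qed.

End Veronese.

Section VeroneseExists.
Variables (k : closedFieldType) (K : fieldType) (frac : {rmorphism {poly k} -> K}).
Hypothesis frac_inj : injective frac.
Hypothesis frac_repr : forall x, exists p q : {poly k}, q != 0 /\ x = frac p / frac q.
Local Notation kst := {poly {poly k}}.
Local Notation const := (frac \o polyC).
Local Notation ev u := (horner_eval u \o map_poly const).

Variables (B : gradedAlg k) (Phi : {rmorphism B -> kst}).
Hypothesis PhiP : curve_embedding Phi.
Hypothesis B_ind : generated_in_degree1 B.
Hypothesis B_integral : degree1_integrally_closed B.
Hypothesis B_span : degree1_finite B.

Local Notation W := (in_image Phi).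

(** The function field of the projective curve attached to B: fractions of
    degree 0. *)
Definition degree0_fractions : {pred K} := fun y => `[< exists d p q,
  [/\ q != 0, W d p, W d q & y = frac p / frac q] >].

Let frac_neq0 p : p != 0 -> frac p != 0.
Proof. by move=> nzp; rewrite -(rmorph0 frac) (inj_eq frac_inj). Qed.

Lemma degree0_fractions_divring : divring_closed degree0_fractions.
Proof.
split=> [|x y /asboolP[d [p [q [nzq Wp Wq ->]]]] /asboolP[d' [p' [q' [nzq' Wp' Wq' ->]]]]|
  x y /asboolP[d [p [q [nzq Wp Wq ->]]]] /asboolP[d' [p' [q' [nzq' Wp' Wq' ->]]]]].
- apply/asboolP; exists 0%N, 1, 1; rewrite oner_neq0 rmorph1 divr1.
  by split=> //; exact: in_image1.
- apply/asboolP; exists (d + d')%N, (p * q' - q * p'), (q * q').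
  split; [by rewrite mulf_neq0|by apply: (in_imageB PhiP); apply: in_imageM|exact: in_imageM|].
  rewrite rmorphB !rmorphM; move: (frac_neq0 nzq) (frac_neq0 nzq').
  by move: (frac p) (frac q) (frac p') (frac q') => P Q P' Q' nzQ nzQ'; field; apply/andP.
have [p'0|nzp'] := eqVneq p' 0.
  apply/asboolP; exists 0%N, 0, 1; rewrite oner_neq0 p'0 !rmorph0 !mul0r invr0 mulr0.
  by split=> //; [exact: in_image0 | exact: in_image1].
apply/asboolP; exists (d + d')%N, (p * q'), (q * p').
split; [by rewrite mulf_neq0|exact: in_imageM|exact: in_imageM|].
by rewrite !rmorphM invf_div mulf_div.
Qed.

Lemma degree0_fractions_const c : const c \in degree0_fractions.
Proof.
apply/asboolP; exists 0%N, c%:P, 1; rewrite oner_neq0 rmorph1 divr1.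
by split=> //; [exact: in_image_const | exact: in_image1].
Qed.

Lemma embedding_degree1 (u h : K) (Psi : {rmorphism B -> kst}) b (p Q : {poly k}) :
    (forall c, u != const c) -> h != 0 ->
    (forall b, substitution frac u h (Psi b) = map_poly frac (Phi b)) ->
    Phi b = p *: 'X -> frac p = ev u Q * h -> Psi b = Q *: 'X.
Proof.
move=> u_nonconst nzh PsiE bE pE.
apply: (substitution_inj u_nonconst nzh).
rewrite -[in RHS](expr1 'X) substitution_scale !expr1 -pE PsiE bE.
by rewrite map_polyZ map_polyX.
Qed.

(** With u a generator of the field of fractions of degree 0, the elements of
    degree 1 of B are the P1 i (u) up to a common factor in k(s). The substitution
    t := h t absorbs this factor and the greatest common divisor G of the P1 i,
    which leaves polynomials without common root. *)
Lemma rational_case : (exists2 y, y \in degree0_fractions & forall c, y != const c) ->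
  exists Psi : {rmorphism B -> kst}, curve_embedding Psi /\ veronese_embedding Psi.
Proof.
have [Phi_inj PhiZ Phi_grad] := PhiP.
pose F : divringClosed K := HB.pack degree0_fractions
  (GRing.isDivringClosed.Build K degree0_fractions degree0_fractions_divring).
move=> /(luroth frac_inj frac_repr (F := F) degree0_fractions_const).
move=> [u [/asboolP[d [p [q [nzq Wp Wq uE]]]] u_nonconst rational]].
have [N [m [m1 m_span]]] := B_span.
have /choice[f fE] i : exists p, Phi (m i) = p *: 'X^1 := Phi_grad 1%N _ (m1 i).
have Phi_span b : b \in hcomp B 1 -> exists c : 'I_N -> k,
    b = \sum_i c i *: m i /\ Phi b = (\sum_i c i *: f i) *: 'X.
  move=> /m_span[c bE]; exists c; split=> //; rewrite {1}bE raddf_sum scaler_suml.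
  by apply: eq_bigr => i _; rewrite /= PhiZ fE expr1 mul_polyC scalerA mul_polyC.
have [[i0 nzf]|f0] := pselect (exists i, f i != 0); last first.
  exists Phi; split=> //; exists 0%N; split=> // b /Phi_span[c [_ ->]].
  exists 0; rewrite ?size_poly0 // big1 // => i _; apply/eqP; rewrite scaler_eq0.
  by apply/orP; right; apply: contrapT => /negP nzfi; apply: f0; exists i.
have nzff : frac (f i0) != 0 by exact: frac_neq0.
have F_ratio i : frac (f i) / frac (f i0) \in F.
  by apply/asboolP; exists 1%N, (f i), (f i0); split=> //; [exists (m i) | exists (m i0)].
have /choice[PQ PQE] i : exists PQ : {poly k} * {poly k}, ev u PQ.2 != 0 /\
    frac (f i) / frac (f i0) = ev u PQ.1 / ev u PQ.2.
  by have [P [Q [nzQ eq]]] := rational _ (F_ratio i); exists (P, Q).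
(* D is a common denominator of the ratios of the f i to f i0. *)
pose D := \prod_i (PQ i).2; pose P1 i := (PQ i).1 * \prod_(j | j != i) (PQ j).2.
have nzD : ev u D != 0.
  by rewrite rmorph_prod; apply/prodf_neq0 => i _; have [] := PQE i.
have P1E i : frac (f i) = ev u (P1 i) * (frac (f i0) / ev u D).
  have [nzQ /(canRL (divfK nzff)) ->] := PQE i.
  have DE : ev u D = ev u (PQ i).2 * ev u (\prod_(j | j != i) (PQ j).2).
    by rewrite -rmorphM /D (bigD1 i).
  have -> : ev u (P1 i) = ev u (PQ i).1 * ev u (\prod_(j | j != i) (PQ j).2).
    by rewrite -rmorphM.
  rewrite DE in nzD *; move: nzQ nzD.
  move: (ev u (PQ i).1) (ev u (PQ i).2) (ev u (\prod_(j | j != i) (PQ j).2)) (frac _).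
  move=> x y z w nzy; rewrite mulf_eq0 negb_or nzy /= => nzz; field.
  by rewrite nzy nzz.
have [|G [P [a [nzG PE bezout]]]] := @poly_bezout k N P1.
  exists i0; apply: contraNneq nzff => P10.
  by rewrite P1E P10 rmorph0 mul0r.
pose h := ev u G * (frac (f i0) / ev u D).
have nzh : h != 0.
  rewrite !mulf_neq0 ?invr_eq0 //.
  by rewrite -(rmorph0 (ev u)) (inj_eq (transcendental u_nonconst)).
have fP i : frac (f i) = ev u (P i) * h.
  by rewrite P1E PE rmorphM -mulrA.
have fP_sum (c : 'I_N -> k) : frac (\sum_i c i *: f i) = ev u (\sum_i c i *: P i) * h.
  rewrite !rmorph_sum mulr_suml; apply: eq_bigr => i _.
  rewrite -!mul_polyC !rmorphM fP mulrA; congr (_ * _ * _).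
  by rewrite /= map_polyC /horner_eval hornerC.
have [|Psi [PsiP PsiE]] := reparametrize frac_inj PhiP B_ind u_nonconst nzh.
  by move=> b /Phi_span[c [_ bE]]; eexists; eexists; split; [exact: bE | exact: fP_sum].
have Psi1 b (c : 'I_N -> k) : Phi b = (\sum_i c i *: f i) *: 'X ->
    Psi b = (\sum_i c i *: P i) *: 'X.
  by move=> bE; apply: (embedding_degree1 u_nonconst nzh PsiE bE (fP_sum c)).
exists Psi; split=> //.
apply: (veronese B_integral PsiP (P := P) (a := a)) => // [i|p1 [b b1 bE]|].
- exists (m i) => //; rewrite expr1.
  by apply: (embedding_degree1 u_nonconst nzh PsiE (p := f i)).
- have [c [_ /Psi1]] := Phi_span b b1; rewrite bE expr1 => eq; exists c.
  by move: eq; rewrite -['X]expr1 => /scaleXn_inj.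
have [b bd bE] := Wp; have [b' b'd b'E] := Wq.
have [_ _ Psi_grad] := PsiP; have [r rE] := Psi_grad d _ b'd.
exists d, r; split; [|split].
- apply: contraNneq nzq => r0; apply/eqP/(@scaleXn_inj _ d); rewrite scale0r -b'E.
  have [Psi_inj _ _] := PsiP.
  by have -> : b' = 0; [apply: Psi_inj; rewrite rE r0 scale0r raddf0 | rewrite raddf0].
- by exists b'.
exists b => //; apply: (substitution_inj u_nonconst nzh).
rewrite PsiE bE substitution_scale.
have := PsiE b'; rewrite rE b'E substitution_scale !map_polyZ !map_polyXn => /scaleXn_inj rq.
have XrE : ev u ('X * r) = u * ev u r.
  by rewrite rmorphM; congr (_ * _); rewrite /= map_polyX /horner_eval hornerX.
by rewrite XrE -mulrA rq uE divfK // frac_neq0.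
Qed.

(** Elements of the same degree of B are then proportional: B is k or k[t]. The
    choice of frac 'X for u is arbitrary. *)
Lemma constant_case : (forall y, y \in degree0_fractions -> exists c, y = const c) ->
  exists Psi : {rmorphism B -> kst}, curve_embedding Psi /\ veronese_embedding Psi.
Proof.
have [Phi_inj PhiZ Phi_grad] := PhiP => allconst.
have [[b0 b01 nzb0]|B1_0] := pselect (exists2 b, b \in hcomp B 1 & b != 0); last first.
  exists Phi; split=> //; exists 0%N; split=> // b b1.
  exists 0; rewrite ?size_poly0 // scale0r; suff -> : b = 0 by rewrite raddf0.
  by apply/eqP; apply: contrapT => /negP nzb; apply: B1_0; exists b.
have [p0 p0E] := Phi_grad _ _ b01.
have nzp0 : p0 != 0.
  by apply: contraNneq nzb0 => p00; apply/eqP/Phi_inj; rewrite p0E p00 scale0r raddf0.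
have nzh := frac_neq0 nzp0.
have u_nonconst c : frac 'X != const c.
  rewrite /= (inj_eq frac_inj); apply/eqP => /(congr1 (fun p : {poly k} => size p)).
  by rewrite size_polyX size_polyC; case: (c != 0).
have Phi1 b : b \in hcomp B 1 -> exists p c, Phi b = p *: 'X /\
    frac p = ev (frac 'X) c%:P * frac p0.
  move=> b1; have [p pE] := Phi_grad _ _ b1.
  have [|c cE] := allconst (frac p / frac p0).
    by apply/asboolP; exists 1%N, p, p0; split=> //; [exists b | exists b0].
  exists p, c; rewrite pE expr1; split=> //.
  by rewrite /= map_polyC /horner_eval hornerC -[LHS](divfK nzh) cE.
have [|Psi [PsiP PsiE]] := reparametrize frac_inj PhiP B_ind u_nonconst nzh.
  by move=> b /Phi1[p [c pc]]; exists p, c%:P.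
exists Psi; split=> //; exists 1%N; split=> [b /Phi1[p [c [bE pE]]]|j].
  exists c%:P; first by rewrite size_polyC leq_b1.
  exact: (embedding_degree1 u_nonconst nzh PsiE bE pE).
rewrite ltnS leqn0 => /eqP ->; exists b0 => //; rewrite expr0.
apply: (embedding_degree1 u_nonconst nzh PsiE (p := p0)); first by rewrite p0E expr1.
by rewrite rmorph1 mul1r.
Qed.

Lemma veronese_exists :
  exists Psi : {rmorphism B -> kst}, curve_embedding Psi /\ veronese_embedding Psi.
Proof.
have [[y [Fy y_nonconst]]|no] := pselect (exists y, y \in degree0_fractions /\
  forall c, y != const c).
  by apply: rational_case; exists y.
apply: constant_case => y Fy; apply: contrapT => /forallNP yc; apply: no.
by exists y; split=> // c; apply/eqP.
Qed.

End VeroneseExists.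

(** * The polytopal algebra of a segment *)

Section Segment.
Variables (R : realType) (N : nat).

Let generators : seq 'rV[int]_1 := [seq const_mx j%:Z | j <- iota 0 N].

Lemma segment_subproof : exists s : seq 'rV[int]_1,
  conv_hull [seq lattice_pt R x | x <- generators] = conv_hull [seq lattice_pt R x | x <- s].
Proof. by exists generators. Qed.

(** The segment [0, N - 1]; it is empty for N = 0, which accounts for B = k. *)
Definition segment : latticePolytope R 1 := LatticePolytope segment_subproof.

Lemma segment_lattice_points (x : 'rV[int]_1) :
  lattice_points segment x <-> exists2 j, (j < N)%N & x = const_mx j%:Z.
Proof.
pose T := [seq lattice_pt R y | y <- generators].
have szT : size T = N by rewrite !size_map size_iota.
have lt_iN (i : 'I_(size T)) : (i < N)%N by have := ltn_ord i; rewrite [X in (_ < X)%N]szT.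
have TE i : (i < N)%N -> T`_i = const_mx i%:R.
  move=> iN; rewrite (nth_map 0) ?size_map ?size_iota // (nth_map 0%N) ?size_iota //.
  by rewrite nth_iota // add0n; apply/rowP => j; rewrite !mxE.
split=> [[c [c0 c1 xE]]|[j jN ->]].
  have N_gt0 : (0 < N)%N.
    rewrite lt0n; apply: contraTneq (oner_neq0 R) => N0; rewrite negbK -c1.
    by apply/eqP/big1 => i _; have := lt_iN i; rewrite N0.
  have x0E : (x 0 0)%:~R = \sum_i c i * i%:R :> R.
    have /(congr1 (fun y : 'rV[R]_1 => y 0 0)) := xE; rewrite mxE => ->.
    rewrite summxE; apply: eq_bigr => i _; rewrite mxE; congr (_ * _).
    by rewrite TE ?mxE // lt_iN.
  have x_ge0 : 0 <= x 0 0.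
    by rewrite -(ler0z R) x0E sumr_ge0 // => i _; rewrite mulr_ge0 // ler0n.
  have x_lt : x 0 0 < N%:Z.
    have : (x 0 0)%:~R <= (N.-1)%:R :> R.
      rewrite x0E -[leRHS]mul1r -[X in X * _]c1 mulr_suml; apply: ler_sum => i _.
      by rewrite ler_wpM2l // ler_nat -ltnS prednK // lt_iN.
    rewrite -[_%:R]/((N.-1)%:Z%:~R) ler_int.
    by move: (x 0 0) x_ge0 => z; lia.
  exists `|x 0%R 0%R|%N; first by move: (x 0 0) x_ge0 x_lt => z; lia.
  by apply/rowP => i; rewrite mxE ord1 gez0_abs.
have jT : (j < size T)%N by rewrite szT.
exists (fun i => (i == Ordinal jT)%:R); split.
- by move=> i; rewrite ler0n.
- by rewrite (bigD1 (Ordinal jT)) //= eqxx big1 ?addr0 // => i /negPf ->.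
rewrite (bigD1 (Ordinal jT)) //= eqxx scale1r big1 ?addr0 => [|i /negPf ->]; last first.
  by rewrite scale0r.
by rewrite -/T TE //; apply/rowP => i; rewrite !mxE.
Qed.

End Segment.

Section SegmentAlgebra.
Variables (R : realType) (k : closedFieldType) (N : nat).
Local Notation Q := (segment R N).
Local Notation kQ := {malg k[SP Q]}.
Local Notation kst := {poly {poly k}}.
Let coord (v : SP Q) : nat := `|val v 0%R (lshift 1 0%R)|%N.

Let coordE (v : SP Q) : val v 0 (lshift 1 0) = (coord v)%:Z.
Proof.
rewrite gez0_abs //; have [s [sQ ->]] := asboolW (valP v).
rewrite summxE big_seq_cond; apply: sumr_ge0 => x /andP[/sQ/segment_lattice_points[j _ ->] _].
by rewrite row_mxEl mxE.
Qed.

(** The monomial with exponent (j, d) is mapped to s^j t^d. *)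
Lemma segment_embedding : exists Theta : {rmorphism polytope_alg k Q -> kst},
  curve_embedding Theta /\
  forall j (Pj : lattice_points Q (const_mx j%:Z)), Theta << degree1 Pj >> = 'X^j *: 'X.
Proof.
have [||Theta [ThetaZ ThetaU Theta_grad]] := @polytope_eval R k 1 Q (fun v => 'X^(coord v)).
- by rewrite /coord mxE expr0.
- move=> u v; rewrite -exprD; congr (_ ^+ _); apply/eqP; rewrite -eqz_nat PoszD.
  by rewrite -!coordE /= mxE.
exists Theta; split; last first.
  move=> j Pj; rewrite ThetaU; congr ('X^_ *: _).
    by apply/eqP; rewrite -eqz_nat -coordE /= row_mxEl mxE.
  by rewrite /sdeg /= last_coord_homogenize expr1.
split=> // [|d a ad]; last by eexists; apply: Theta_grad.
suff ker (a : kQ) : Theta a = 0 -> a = 0 by apply: raddf_inj ker.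
move=> Theta0; apply/malgP => w; rewrite mcoeff0.
have [wa|/mcoeff_outdom //] := boolP (w \in msupp a).
have term (v : SP Q) :
    (Theta << a@_v *g v >>)`_(sdeg w)`_(coord w) = if v == w then a@_v else 0.
  have -> : << a@_v *g v >> = a@_v *: << v >> :> kQ by apply: monalgU_scale.
  rewrite [Theta _]ThetaZ ThetaU coefCM coefZ coefXn.
  have [->|vw] := eqVneq v w; first by rewrite eqxx mulr1 coefCM coefXn eqxx mulr1.
  case: eqP => [dE|_]; last by rewrite !mulr0 coef0.
  rewrite mulr1 coefCM coefXn; case: eqP => [cE|_]; last by rewrite mulr0.
  case/eqP: vw; apply/val_inj/rowP => i; case: (split_ordP i) => j ->; rewrite (ord1 j).
    by rewrite !coordE cE.
  by rewrite -[LHS]/(last_coord (val v)) -[RHS]/(last_coord (val w)) !sdegE dE.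
have aw : (Theta a)`_(sdeg w)`_(coord w) = a@_w.
  rewrite {1}[a]monalgE raddf_sum !coef_sum (eq_bigr _ (fun v _ => term v)).
  rewrite (bigD1_seq w) ?fset_uniq //= eqxx big1 ?addr0 // => v /negPf ->.
  by [].
by rewrite -aw Theta0 !coef0.
Qed.

Variables (B : gradedAlg k) (Psi : {rmorphism B -> kst}).
Hypothesis PsiP : curve_embedding Psi.
Hypothesis B_ind : generated_in_degree1 B.
Hypothesis Psi1 : forall b, b \in hcomp B 1 ->
  exists2 p : {poly k}, (size p <= N)%N & Psi b = p *: 'X.
Hypothesis Psi_onto : forall j, (j < N)%N -> exists2 b, b \in hcomp B 1 & Psi b = 'X^j *: 'X.

(** Both algebras have the same image in k[s][t], since they are generated in
    degree 1. *)
Lemma segment_iso : graded_iso B (polytope_alg k Q).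
Proof.
have [Theta [ThetaP Theta1]] := segment_embedding.
have [Psi_inj PsiZ Psi_grad] := PsiP; have [Theta_inj ThetaZ Theta_grad] := ThetaP.
have lattice_pt j : (j < N)%N -> lattice_points Q (const_mx j%:Z).
  by move=> jN; apply/segment_lattice_points; exists j.
have [|F [Fhom FE]] := lift_lrmorphism PsiP ThetaP.
  apply: B_ind => [c|b b' [a aE] [a' aE']|b b' [a aE] [a' aE']|b /Psi1[p szp bE]].
  - by exists (c *: 1); rewrite ThetaZ PsiZ !rmorph1.
  - by exists (a + a'); rewrite !rmorphD aE aE'.
  - by exists (a * a'); rewrite !rmorphM aE aE'.
  pose mono (i : 'I_N) : polytope_alg k Q := << degree1 (lattice_pt i (ltn_ord i)) >>.
  exists (\sum_(i < N) p`_i *: mono i); rewrite bE raddf_sum.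
  have {2}-> : p = \sum_(i < N) p`_i *: 'X^i.
    apply/polyP => i; rewrite coef_sum; have [iN|Ni] := ltnP i N.
      rewrite (bigD1 (Ordinal iN)) //= coefZ coefXn eqxx mulr1 big1 ?addr0 // => j.
      by rewrite -val_eqE /= coefZ coefXn eq_sym => /negPf ->; rewrite mulr0.
    rewrite nth_default ?(leq_trans szp) // big1 // => j _.
    by rewrite coefZ coefXn gtn_eqF ?mulr0 // (leq_trans _ Ni).
  rewrite scaler_suml; apply: eq_bigr => i _.
  by rewrite /= ThetaZ Theta1 mul_polyC scalerA mul_polyC.
have [|G [Ghom GE]] := lift_lrmorphism ThetaP PsiP.
  apply: (@polytope_alg_ind R k 1 Q (fun a => exists b, Psi b = Theta a)).
  - by move=> c; exists (c *: 1); rewrite ThetaZ PsiZ !rmorph1.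
  - by move=> a a' [b bE] [b' bE']; exists (b + b'); rewrite !rmorphD bE bE'.
  - by move=> a a' [b bE] [b' bE']; exists (b * b'); rewrite !rmorphM bE bE'.
  move=> x Px; have [j jN xE] := (segment_lattice_points R N x).1 Px.
  by subst x; have [b _ bE] := Psi_onto jN; exists b; rewrite bE Theta1.
exists F, G; split=> // a.
  by apply: Psi_inj; rewrite GE FE.
by apply: Theta_inj; rewrite FE GE.
Qed.

End SegmentAlgebra.

Theorem theorem2p2 (R : realType) (k : closedFieldType) (A B : gradedAlg k)
    (hA : polytopal R A) (hB : graded_retract A B)
    (hdim : krull_dim_le B 2) :
  polytopal R B.
Proof.
have [n [P [i [i' [ihom i'hom iK i'K]]]]] := hA.
have [f0 [g0 [f0hom g0hom f0K]]] := hB.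
pose f : {lrmorphism B -> polytope_alg k P} := i \o f0.
pose g : {lrmorphism polytope_alg k P -> B} := g0 \o i'.
have fhom : homogeneous f by move=> d b bd; apply/ihom/f0hom.
have ghom : homogeneous g by move=> d a ad; apply/g0hom/i'hom.
have fK : cancel f g by move=> b; rewrite /= iK f0K.
have [Phi PhiP] := retract_to_curve fhom ghom fK hdim.
have frac_inj : injective (@tofrac {poly k}).
  by move=> p q /eqP; rewrite tofrac_eq => /eqP.
have [Psi [PsiP [N [Psi1 Psi_onto]]]] := veronese_exists frac_inj (@fraction_repr k)
  PhiP (retract_ind ghom fK) (retract_almost_integral fhom ghom fK)
  (retract_degree1_span fhom ghom fK).
exists 1%N, (segment R N).
exact: segment_iso PsiP (retract_ind ghom fK) Psi1 Psi_onto.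
Qed.
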